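(* Let $m\ge 1$ be an integer. If $m=2k-1$ with $k\ge1$ an integer, then $\operatorname{MaxCol}(m+1,3)\ge 2^{k+2}+2^{k-1}-3k-5$. If $m=2k$ with $k\ge 1$ an integer, then $\operatorname{MaxCol}(m+1,3)\ge 2^{k+2}+2^{k+1}-3k-6$.
   Context: $\operatorname{MaxCol}(n,d)$ denotes the maximum number of collisions that may occur between $n$ identical hard balls moving freely and colliding elastically in $\mathbb{R}^d$ (open space), where simultaneous collisions are prohibited. (It is known to be finite; $\operatorname{MaxCol}(n,d)\ge N$ means that there is a trajectory with at least $N$ collisions.) Precisely: the balls have radius $\frac12$ and centers $q_1,\dots,q_n\in\mathbb{R}^d$; a configuration is a point $q=(q_1,\dots,q_n)\in\mathbb{R}^{dn}$, and the configuration space is $\mathcal B_{d,n}=\{q\in\mathbb{R}^{dn}: |q_i-q_j|\ge 1 \text{ for all } i\ne j\}$. For $i<j$ let $C_{ij}=\{q\in\mathbb{R}^{dn}:|q_i-q_j|<1\}$; the walls are the boundaries $\partial C_{ij}=\{|q_i-q_j|=1\}$. At a point $q\in\partial C_{ij}$ the unit outer normal to $C_{ij}$ is the vector $\nu\in\mathbb{R}^{dn}$ whose $i$th $d$-dimensional component is $\frac1{\sqrt2}(q_i-q_j)$, whose $j$th one is $\frac1{\sqrt2}(q_j-q_i)$, and whose other components are $0$. A trajectory is a continuous piecewise linear curve $\gamma\colon I\to\mathcal B_{d,n}$ on an interval $I\subset\mathbb{R}$ which never lies on two distinct walls at the same moment (no simultaneous collisions), is linear near every moment at which it lies on no wall,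 and at every moment $t$ at which it lies on a wall with normal $\nu$ at $\gamma(t)$ satisfies the elastic (billiard) reflection rule $\gamma'(t_+)=\gamma'(t_-)-2\langle\gamma'(t_-),\nu\rangle\nu$. A collision is a moment $t$ at which $\gamma(t)$ lies on a wall and $\langle\gamma'(t_-),\nu\rangle\ne0$; no collisions occur at endpoints of $I$. *)

(* Defs.v *)
From HB Require Import structures.
From mathcomp Require Import all_boot all_order all_algebra.
From mathcomp Require Import all_classical all_reals all_analysis.

Set Implicit Arguments.
Unset Strict Implicit.
Unset Printing Implicit Defensive.

Import Order.TTheory GRing.Theory Num.Theory.
Import numFieldTopology.Exports numFieldNormedType.Exports.

Local Open Scope classical_set_scope.
Local Open Scope ring_scope.

Section HardBalls.
Variables (R : realType) (n d : nat).

(* The norm [`|_|] of the library on matrices is the sup norm, hence the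
   explicit Euclidean inner product and norm. *)
Definition inner (p r : nat) (u v : 'M[R]_(p, r)) : R :=
  \sum_(a < p) \sum_(b < r) u a b * v a b.

Definition enorm (p r : nat) (u : 'M[R]_(p, r)) : R := Num.sqrt (inner u u).

(* A configuration q = (q_1, ..., q_n) in R^(dn) is an n x d matrix whose
   i-th row is the center q_i. *)
Definition dist_centers (q : 'M[R]_(n, d)) (i j : 'I_n) : R :=
  enorm (row i q - row j q).

Definition config_space : set 'M[R]_(n, d) :=
  [set q | forall i j : 'I_n, i != j -> 1 <= dist_centers q i j].

(* the boundary of C_ij = {q | |q_i - q_j| < 1} *)
Definition wall (i j : 'I_n) : set 'M[R]_(n, d) :=
  [set q | dist_centers q i j = 1].

Definition normal (i j : 'I_n) (q : 'M[R]_(n, d)) : 'M[R]_(n, d) :=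
  \matrix_(a < n)
    if a == i then (Num.sqrt 2)^-1 *: (row i q - row j q)
    else if a == j then (Num.sqrt 2)^-1 *: (row j q - row i q)
    else 0.

(* gamma'(t_-) and gamma'(t_+). *)
Definition left_velocity (gamma : R -> 'M[R]_(n, d)) (t : R) : 'M[R]_(n, d) :=
  lim ((fun h : R => h^-1 *: (gamma (t + h) - gamma t)) @ 0^'-).

Definition right_velocity (gamma : R -> 'M[R]_(n, d)) (t : R) : 'M[R]_(n, d) :=
  lim ((fun h : R => h^-1 *: (gamma (t + h) - gamma t)) @ 0^'+).

(* Linearity near t of the restriction of gamma to A; t is meant to be in A. *)
Definition linear_near (A : set R) (gamma : R -> 'M[R]_(n, d)) (t : R) : Prop :=
  exists v : 'M[R]_(n, d),
    \forall s \near t, A s -> gamma s = gamma t + (s - t) *: v.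

(* Linear on each side of every moment of I; by compactness this amounts to
   finitely many linear pieces on each compact subinterval of I. *)
Definition piecewise_linear (I : set R) (gamma : R -> 'M[R]_(n, d)) : Prop :=
  forall t, I t ->
    linear_near (I `&` [set s | s <= t]) gamma t /\
    linear_near (I `&` [set s | t <= s]) gamma t.

(* gamma is total, but only its values on I are constrained. In
   [traj_reflection] the moment t is required to be interior to I: at an
   endpoint only one of the two velocities makes sense, and no contact between
   balls is allowed there. *)
Record trajectory (I : set R) (gamma : R -> 'M[R]_(n, d)) : Prop := {
  traj_interval : is_interval I;
  traj_config : forall t, I t -> config_space (gamma t);
  traj_continuous : {within I, continuous gamma};
  traj_piecewise_linear : piecewise_linear I gamma;
  traj_no_simultaneous : forall t (i j k l : 'I_n), I t ->
    (i < j)%N -> (k < l)%N -> wall i j (gamma t) -> wall k l (gamma t) ->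
    (i, j) = (k, l);
  traj_free : forall t, I t ->
    (forall i j : 'I_n, (i < j)%N -> ~ wall i j (gamma t)) ->
    linear_near I gamma t;
  traj_reflection : forall t (i j : 'I_n), I t ->
    (i < j)%N -> wall i j (gamma t) ->
    I° t /\
    right_velocity gamma t =
      left_velocity gamma t -
      (2 * inner (left_velocity gamma t) (normal i j (gamma t)))
        *: normal i j (gamma t)
}.

Definition collisions (I : set R) (gamma : R -> 'M[R]_(n, d)) : set R :=
  [set t | I° t /\ exists i j : 'I_n,
    [/\ (i < j)%N, wall i j (gamma t) &
        inner (left_velocity gamma t) (normal i j (gamma t)) != 0]].

Definition has_trajectory_with_collisions (N : nat) : Prop :=
  exists (I : set R) (gamma : R -> 'M[R]_(n, d)),
    trajectory I gamma /\ (`I_N #<= collisions I gamma)%card.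

(* The supremum is taken in the extended reals, so that the definition does not
   presuppose that the number of collisions is bounded. *)
Definition MaxCol : \bar R :=
  ereal_sup [set (N%:R)%:E | N in [set N | has_trajectory_with_collisions N]].

Lemma MaxCol_geP (N : nat) :
  ((N%:R)%:E <= MaxCol)%E <-> has_trajectory_with_collisions N.
Proof.
split=> [|hN]; last by apply: ereal_sup_ubound; exists N.
case: N => [_|N leN].
  exists set0, (fun=> 0); split; last by rewrite II0 card_ge0.
  by split=> //; exact: continuous_subspace0.
have /ereal_sup_gt[_ [M [I [gamma [tr cM]]] <-]] :
    (((N%:R)%:E : \bar R) < MaxCol)%E.
  by apply: lt_le_trans leN; rewrite lte_fin ltr_nat.
rewrite lte_fin ltr_nat => ltNM.
exists I, gamma; split=> //.
by apply: card_le_trans cM; rewrite card_le_II.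
Qed.

End HardBalls.

Arguments MaxCol R n d : clear implicits.

(* Main.v *)
Require Import Defs.
From mathcomp Require Import all_boot all_order all_algebra.
From mathcomp Require Import all_classical all_reals all_analysis.
From mathcomp Require Import ring lra zify.

Set Implicit Arguments.
Unset Strict Implicit.
Unset Printing Implicit Defensive.

Import Order.TTheory GRing.Theory Num.Theory.
Import numFieldTopology.Exports numFieldNormedType.Exports.

Local Open Scope classical_set_scope.
Local Open Scope ring_scope.

(** The collisions all happen near one configuration of touching balls, a
    caterpillar tree of contacts in which two contacts at the same ball are nearly
    orthogonal. At a small enough scale each contact [f] becomes a flat wall with
    a gap [x_f >= 0] and a speed [u_f], a hit of [f] changes the sign of [u_f], and
    for a contact [e] at the same ball it moves [u_e] by [u_f] times minus twice
    the scalar product of the two normals.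

    Let [eps] be small, and let the speed at the wall number [f] be of order
    [eps ^ f] and the scalar product of the normals of two walls [e < f] at the
    same ball be [- eps ^ (f - e)]. In the limit the hits of [f] have no effect on
    the walls before it, while each hit of an earlier wall at the same ball exactly
    reverses the motion orthogonal to [f], if that motion recedes: the wall [f] is
    kicked. So the point goes back and forth at unit speed, hitting [f] once
    between two consecutive kicks, once before the first kick and once after the
    last one, and [f] has one hit more than it has kicks. Along the caterpillar the
    walls come in pairs. If [n] is the number of hits of the last wall of a pair,
    then the next two walls have [n + 1] and [n + (n + 1) + 1 = 2 n + 2] hits: one
    more pair of balls doubles the number of collisions.

    A kick of [f] must come at the midpoint of two consecutive hits of [f].
    Conversely, finite sets of hits with this property and without common moments
    describe a motion in the limit ([shadow_reach_run]). They are built wall after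
    wall, close to arithmetic progressions, with a generic offset that separates
    the moments ([schedule_near]). All the hits in the limit are transversal, so
    that the true trajectories follow them for small [eps] ([shadow_reach_hit]);
    the true trajectories are assembled from free flights and bounces
    ([reach_drift], [reach_bounce]). The caterpillar is realized by unit vectors
    with the required scalar products in space ([caterpillar]), where three nearly
    orthogonal directions are available at each ball. *)

(** * Trajectories made of free flights and bounces *)

Section Flights.
Variables (R : realType) (n d : nat).
Implicit Types (q v : 'M[R]_(n, d)) (i j k : 'I_n) (gam : R -> 'M[R]_(n, d)).

(** The scalar product of the relative position and the relative velocity of two
    balls; [rdot q q i j] is their squared distance. *)
Definition rdot q v i j : R := \sum_a (q i a - q j a) * (v i a - v j a).

Lemma rdotC q v i j : rdot q v i j = rdot q v j i.
Proof. by apply: eq_bigr => a _; ring. Qed.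

Lemma rdot_ge0 q i j : 0 <= rdot q q i j.
Proof. by apply: sumr_ge0 => a _; rewrite -expr2 sqr_ge0. Qed.

Lemma rdot_line q v s i j : rdot (q + s *: v) (q + s *: v) i j =
  rdot q q i j + 2 * s * rdot q v i j + s ^+ 2 * rdot v v i j.
Proof.
rewrite /rdot !mulr_sumr -!big_split; apply: eq_bigr => a _ /=.
by rewrite !mxE; ring.
Qed.

Lemma rdot_linel q w v s i j :
  rdot (q + s *: w) v i j = rdot q v i j + s * rdot w v i j.
Proof.
rewrite /rdot !mulr_sumr -!big_split; apply: eq_bigr => a _ /=.
by rewrite !mxE; ring.
Qed.

Lemma dist_rdot q i j : dist_centers q i j = Num.sqrt (rdot q q i j).
Proof.
rewrite /dist_centers /enorm /inner big_ord1; congr Num.sqrt.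
by apply: eq_bigr => a _; rewrite !mxE.
Qed.

Lemma wall_rdot q i j : wall i j q <-> rdot q q i j = 1.
Proof.
rewrite /wall /= dist_rdot; split=> [h|->]; last by rewrite sqrtr1.
by rewrite -(sqr_sqrtr (rdot_ge0 q i j)) h expr1n.
Qed.

Lemma config_rdot q : config_space q <->
  forall i j, (i < j)%N -> 1 <= rdot q q i j.
Proof.
have E i j : (1 <= dist_centers q i j) = (1 <= rdot q q i j).
  by rewrite dist_rdot -[X in X <= _]sqrtr1 ler_sqrt // rdot_ge0.
split=> [h i j lij|h i j nij].
  by rewrite -E; apply: h; rewrite neq_ltn lij.
rewrite E; case: (ltngtP i j) => [/h //|/h|/val_inj e]; first by rewrite rdotC.
by rewrite e eqxx in nij.
Qed.

Definition apart q := forall i j, (i < j)%N -> 1 < rdot q q i j.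

Definition bounce i j q v :=
  v - (2 * inner v (normal i j q)) *: normal i j q.

Lemma inner_normal i j q v : (i < j)%N ->
  inner v (normal i j q) = (Num.sqrt 2)^-1 * rdot q v i j.
Proof.
move=> lij; have nij : i != j by rewrite neq_ltn lij.
rewrite /inner (bigD1 i) //= (bigD1 j) 1?eq_sym //=.
rewrite [X in _ + (_ + X)]big1 ?addr0 => [|k].
  rewrite /rdot mulr_sumr -big_split; apply: eq_bigr => a _ /=.
  by rewrite !mxE eqxx (eq_sym j) (negPf nij) eqxx !mxE; ring.
case/andP=> nki nkj; rewrite big1 // => a _.
by rewrite !mxE (negPf nki) (negPf nkj) mxE mulr0.
Qed.

Lemma bounceE i j q v k a : (i < j)%N ->
  bounce i j q v k a =
  v k a - rdot q v i j * ((k == i)%:R - (k == j)%:R) * (q i a - q j a).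
Proof.
move=> lij; have nij : i != j by rewrite neq_ltn lij.
rewrite /bounce inner_normal // !mxE.
have s2 : 2 * (Num.sqrt 2)^-1 * (Num.sqrt 2)^-1 = 1 :> R.
  by rewrite -mulrA -invfM -expr2 sqr_sqrtr ?divff.
have E r D : 2 * ((Num.sqrt 2)^-1 * r) * ((Num.sqrt 2)^-1 * D) = r * D :> R.
  transitivity (2 * (Num.sqrt 2)^-1 * (Num.sqrt 2)^-1 * (r * D)).
    by move: (Num.sqrt 2)^-1 => c; ring.
  by rewrite s2 mul1r.
have [->|nki] := eqVneq k i; first by rewrite (negPf nij) !mxE E /=; ring.
by have [->|nkj] := eqVneq k j; rewrite !mxE ?E /=; ring.
Qed.

Lemma near_dist (P : R -> Prop) t :
  (\forall s \near t, P s) <->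
  exists2 e, 0 < e & forall s, t - e < s -> s < t + e -> P s.
Proof.
split=> [/nbhs_ballP[e e0 h]|[e e0 h]].
  by exists e => // s s1 s2; apply: h; rewrite /ball /= ltr_norml; lra.
apply/nbhs_ballP; exists e => // s; rewrite /ball /= ltr_norml => hs.
by apply: h; lra.
Qed.

Lemma near_left0 (P : R -> Prop) e :
  0 < e -> (forall h, - e < h -> h < 0 -> P h) -> \forall h \near 0^'-, P h.
Proof.
move=> e0 hP; near=> h; apply: hP; near: h; first by apply: nbhs_left_gt; lra.
exact: nbhs_left_lt.
Unshelve. all: by end_near. Qed.

Lemma near_right0 (P : R -> Prop) e :
  0 < e -> (forall h, 0 < h -> h < e -> P h) -> \forall h \near 0^'+, P h.
Proof.
move=> e0 hP; near=> h; apply: hP; near: h; first exact: nbhs_right_gt.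
exact: nbhs_right_lt.
Unshelve. all: by end_near. Qed.

Lemma left_velocityE gam t e v : 0 < e ->
  (forall h, - e < h -> h < 0 -> gam (t + h) = gam t + h *: v) ->
  left_velocity gam t = v.
Proof.
move=> e0 gE; apply: lim_near_cst; first exact: norm_hausdorff.
apply: (near_left0 e0) => h h1 h2.
by rewrite gE // addrC addKr scalerA mulVf ?scale1r // lt_eqF.
Qed.

Lemma right_velocityE gam t e v : 0 < e ->
  (forall h, 0 < h -> h < e -> gam (t + h) = gam t + h *: v) ->
  right_velocity gam t = v.
Proof.
move=> e0 gE; apply: lim_near_cst; first exact: norm_hausdorff.
apply: (near_right0 e0) => h h1 h2.
by rewrite gE // addrC addKr scalerA mulVf ?scale1r // gt_eqF.
Qed.

Lemma lim_near_eq (F : set_system R) {FF : Filter F} (f g : R -> 'M[R]_(n, d)) :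
  (\forall h \near F, f h = g h) -> lim (f @ F) = lim (g @ F).
Proof.
move=> fg; congr (lim _); apply/seteqP; split; apply: near_eq_cvg => //.
by apply: filterS fg => h /esym.
Qed.

Lemma left_velocity_local gam gam' t :
  (\forall s \near t, gam' s = gam s) ->
  left_velocity gam' t = left_velocity gam t.
Proof.
move=> /near_dist[e e0 E]; apply: lim_near_eq; apply: (near_left0 e0) => h h1 h2.
by rewrite !E //; lra.
Qed.

Lemma right_velocity_local gam gam' t :
  (\forall s \near t, gam' s = gam s) ->
  right_velocity gam' t = right_velocity gam t.
Proof.
move=> /near_dist[e e0 E]; apply: lim_near_eq; apply: (near_right0 e0) => h h1 h2.
by rewrite !E //; lra.
Qed.

Lemma linear_near_local (A A' : set R) gam gam' t :
  (\forall s \near t, A' s -> A s) ->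
  (\forall s \near t, gam' s = gam s) ->
  linear_near A gam t -> linear_near A' gam' t.
Proof.
move=> AA E [v L]; exists v.
have E0 := nbhs_singleton E.
by apply: filterS3 AA E L => s AA Es L A's; rewrite Es E0; apply/L/AA.
Qed.

(** What a trajectory has to satisfy at the moment [t], apart from continuity. *)
Record regular_at (I : set R) gam t : Prop := Regular {
  reg_config : config_space (gam t);
  reg_left : linear_near (I `&` [set s | s <= t]) gam t;
  reg_right : linear_near (I `&` [set s | t <= s]) gam t;
  reg_single : forall i j k l : 'I_n, (i < j)%N -> (k < l)%N ->
    wall i j (gam t) -> wall k l (gam t) -> (i, j) = (k, l);
  reg_free : (forall i j : 'I_n, (i < j)%N -> ~ wall i j (gam t)) ->
    linear_near I gam t;
  reg_reflection : forall i j : 'I_n, (i < j)%N -> wall i j (gam t) ->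
    I° t /\ right_velocity gam t = bounce i j (gam t) (left_velocity gam t)
}.

Lemma trajectory_regular I gam t : trajectory I gam -> I t -> regular_at I gam t.
Proof.
move=> tr It; have [L Rr] := traj_piecewise_linear tr It; split=> //.
- exact: traj_config tr _ It.
- by move=> i j k l; apply: (traj_no_simultaneous tr) It.
- exact: traj_free tr _ It.
- by move=> i j; apply: (traj_reflection tr) It.
Qed.

Lemma regular_trajectory (I : set R) gam : is_interval I -> continuous gam ->
  (forall t, I t -> regular_at I gam t) -> trajectory I gam.
Proof.
move=> itvI cg reg; split=> //.
- by move=> t /reg[].
- exact: continuous_subspaceT.
- by move=> t /reg[].
- by move=> t i j k l /reg[_ _ _ + _ _]; apply.
- by move=> t /reg[].
- by move=> t i j /reg[_ _ _ _ _]; apply.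
Qed.

(** Regularity is a local property; this is what allows a trajectory to be
    continued without looking again at its past. *)
Lemma regular_local (I I' : set R) gam gam' t :
  (\forall s \near t, I s <-> I' s) -> (\forall s \near t, gam' s = gam s) ->
  regular_at I gam t -> regular_at I' gam' t.
Proof.
move=> II' E; have E0 := nbhs_singleton E.
have AA : \forall s \near t, I' s -> I s by apply: filterS II' => s [].
move=> [c l r s f rf]; split; rewrite ?E0 //.
- by apply: linear_near_local l => //; apply: filterS AA => u h [/h].
- by apply: linear_near_local r => //; apply: filterS AA => u h [/h].
- by move=> /f; apply: linear_near_local.
- move=> i j lij w; have [It vE] := rf i j lij w.
  rewrite (right_velocity_local E) (left_velocity_local E); split=> //.
  by apply: filterS2 II' It => u [h _] /h.
Qed.

Lemma regular_apart (I : set R) gam t e v : apart (gam t) -> 0 < e ->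
  (forall s, I s -> t - e < s -> s < t + e -> gam s = gam t + (s - t) *: v) ->
  regular_at I gam t.
Proof.
move=> ap e0 gE.
have nw i j : (i < j)%N -> ~ wall i j (gam t).
  by move=> /ap h /wall_rdot h1; rewrite h1 ltxx in h.
have lin A : (forall s, A s -> I s) -> linear_near A gam t.
  move=> AI; exists v; apply/near_dist; exists e => // s s1 s2 /AI Is.
  exact: gE.
split.
- by apply/config_rdot => i j /ap/ltW.
- by apply: lin => s [].
- by apply: lin => s [].
- by move=> i j k l lij _ /(nw _ _ lij).
- by move=> _; apply: lin.
- by move=> i j lij /(nw _ _ lij).
Qed.

Lemma regular_bounce (I : set R) gam t i0 j0 q v e : 0 < e -> (i0 < j0)%N ->
  (forall s, t - e < s -> s < t + e -> I s) ->
  (forall s, t - e < s -> s <= t -> gam s = q + (s - t) *: v) ->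
  (forall s, t <= s -> s < t + e -> gam s = q + (s - t) *: bounce i0 j0 q v) ->
  rdot q q i0 j0 = 1 ->
  (forall i j, (i < j)%N -> (i, j) <> (i0, j0) -> 1 < rdot q q i j) ->
  regular_at I gam t.
Proof.
move=> e0 lij0 It gl gr w0 w.
have g0 : gam t = q by rewrite gl ?lexx ?subrr ?scale0r ?addr0 //; lra.
have uniq_wall i j : (i < j)%N -> wall i j (gam t) -> (i, j) = (i0, j0).
  rewrite g0 => lij /wall_rdot wij; case: (pselect ((i, j) = (i0, j0))) => //.
  by move=> /(w i j lij); rewrite wij ltxx.
split.
- rewrite g0; apply/config_rdot => i j lij.
  case: (pselect ((i, j) = (i0, j0))) => [[-> ->]|/(w i j lij)/ltW //].
  by rewrite w0.
- exists v; apply/near_dist; exists e => // s s1 s2 [_ /= st].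
  by rewrite gl // g0.
- exists (bounce i0 j0 q v); apply/near_dist; exists e => // s s1 s2 [_ /= st].
  by rewrite gr // g0.
- by move=> i j k l lij lkl /(uniq_wall _ _ lij) -> /(uniq_wall _ _ lkl).
- by move=> /(_ _ _ lij0); rewrite g0 => /(_ _); case; apply/wall_rdot.
- move=> i j lij /(uniq_wall _ _ lij)[-> ->]; split.
    by apply/near_dist; exists e.
  rewrite g0 (@left_velocityE _ _ e v) // => [|h h1 h2].
    apply: (@right_velocityE _ _ e) => // h h1 h2.
    by rewrite g0 gr ?(addrC t) ?addrK //; lra.
  by rewrite g0 gl ?(addrC t) ?addrK //; lra.
Qed.

(** The state [(q, v)] is reached at time [T] after [N] collisions. The time
    interval is half-open so that [q] itself may lie on a wall, and [gam] goes on
    with velocity [v] after [T]. *)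
Definition reach (N : nat) (T : R) q v := exists gam (s : seq R) (th : R),
  [/\ 0 <= T, 0 < th, continuous gam /\ trajectory `[0, T[ gam,
      (forall t, T - th <= t -> gam t = q + (t - T) *: v) &
      [/\ size s = N, uniq s & forall t, t \in s -> collisions `[0, T[ gam t]].

Lemma reach0 q v : reach 0 0 q v.
Proof.
exists (fun t => q + t *: v), [::], 1; split=> //.
- split.
    by move=> t; apply: cvgD; [exact: cvg_cst|apply: cvgZr_tmp; exact: cvg_id].
  by rewrite set_itvE; split=> //; exact: continuous_subspace0.
- by move=> t _; rewrite subr0.
Qed.

Lemma collisions_local (I I' : set R) gam gam' t :
  (forall s, I s -> I' s) -> (\forall s \near t, gam' s = gam s) ->
  collisions I gam t -> collisions I' gam' t.
Proof.
move=> II' E [It [i [j [lij w nz]]]]; split; first exact: filterS It.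
by exists i, j; rewrite (left_velocity_local E) (nbhs_singleton E).
Qed.

Lemma reach_drift N (T : R) q v (sg : R) : 0 < sg -> reach N T q v ->
  (forall s, 0 <= s -> s < sg -> apart (q + s *: v)) ->
  reach N (T + sg) (q + sg *: v) v.
Proof.
move=> sg0 [gam [s [th [T0 th0 [cg tr] aff [szs us cs]]]]] ap.
exists gam, s, (th + sg); split; [lra|lra| | |split=> //].
- split=> //; apply: regular_trajectory => // [|t]; first exact: interval_is_interval.
  rewrite /= in_itv /= => /andP[t0 tT].
  have [ltT|leT] := ltP t T.
    apply: regular_local (trajectory_regular tr _); last by rewrite /= in_itv /= t0.
      apply/near_dist; exists (T - t); first lra.
      move=> u u1 u2; rewrite /= !in_itv /=.
      by split=> /andP[-> _] /=; lra.
    by apply/near_dist; exists 1.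
  have gt u : t - th < u -> gam u = q + (u - T) *: v by move=> tu; apply: aff; lra.
  apply: (regular_apart (e := th) (v := v)) => // [|u _ u1 _].
    by rewrite gt; [apply: ap; lra|lra].
  rewrite (gt u) // (gt t); last lra.
  by rewrite -addrA -scalerDl; congr (_ + _ *: _); lra.
- move=> t tT; rewrite aff; last lra.
  by rewrite -addrA -scalerDl; congr (_ + _ *: _); lra.
- move=> t /cs; apply: collisions_local; last by apply/near_dist; exists 1.
  by move=> u; rewrite /= !in_itv /= => /andP[-> u2] /=; lra.
Qed.

Lemma reach_bounce N (T : R) q v (sg : R) i0 j0 : 0 < T -> 0 < sg -> reach N T q v ->
  (i0 < j0)%N -> rdot q q i0 j0 = 1 -> rdot q v i0 j0 != 0 ->
  (forall i j, (i < j)%N -> (i, j) <> (i0, j0) -> 1 < rdot q q i j) ->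
  (forall s, 0 < s -> s < sg -> apart (q + s *: bounce i0 j0 q v)) ->
  reach N.+1 (T + sg) (q + sg *: bounce i0 j0 q v) (bounce i0 j0 q v).
Proof.
move=> T0 sg0 [gam [s [th [_ th0 [cg tr] aff [szs us cs]]]]] lij w0 nz w ap.
set v' := bounce _ _ _ _.
pose gam' t := gam t + Num.max (t - T) 0 *: (v' - v).
have gl t : t <= T -> gam' t = gam t.
  by move=> tT; rewrite /gam' max_r ?scale0r ?addr0 //; lra.
have gr t : T <= t -> gam' t = q + (t - T) *: v'.
  move=> tT; rewrite /gam' aff; last lra.
  rewrite max_l; last lra.
  by rewrite -addrA -scalerDr [v + _]addrC subrK.
have near_gl t : t < T -> \forall u \near t, gam' u = gam u.
  move=> tT; apply/near_dist; exists (T - t); first lra.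
  by move=> u _ u2; apply: gl; lra.
pose e := Num.min th (Num.min T sg).
have e0 : 0 < e by rewrite !lt_min th0 T0.
have [e1 e2 e3] : [/\ e <= th, e <= T & e <= sg].
  by split; rewrite !ge_min lexx ?orbT.
have gl' u : T - e < u -> u <= T -> gam' u = q + (u - T) *: v.
  by move=> u1 u2; rewrite gl // aff //; lra.
have inI u : T - e < u -> u < T + e -> [set` `[0, T + sg[] u.
  by move=> u1 u2; rewrite /= in_itv /=; apply/andP; split; lra.
have cg' : continuous gam'.
  move=> t; apply: cvgD; first exact: cg.
  apply: cvgZr_tmp.
  have E u : Num.max (u - T) 0 = (u - T + `|u - T|) / 2.
    by rewrite maxr_absE subr0 addr0.
  under eq_fun do rewrite E.
  rewrite E.
  apply: cvgMr_tmp; apply: cvgD; last apply: cvg_norm; apply: cvgB;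
    by [exact: cvg_id|exact: cvg_cst].
exists gam', (T :: s), sg; split; [lra|exact: sg0|split=> //| |split=> /=].
- apply: regular_trajectory => // [|t]; first exact: interval_is_interval.
  rewrite /= in_itv /= => /andP[t0 tT].
  have [ltT|gtT|eqT] := ltgtP t T.
  + apply: regular_local (trajectory_regular tr _); last by rewrite /= in_itv /= t0.
      apply/near_dist; exists (T - t); first lra.
      move=> u u1 u2; rewrite /= !in_itv /=.
      by split=> /andP[-> _] /=; lra.
    exact: near_gl.
  + apply: (regular_apart (e := t - T) (v := v')); first 1 last; first lra.
      move=> u _ u1 _; rewrite !gr; [|lra|lra].
      by rewrite -addrA -scalerDl; congr (_ + _ *: _); lra.
    by rewrite gr; [apply: ap; lra|lra].
  + rewrite eqT; apply: (regular_bounce e0 lij inI gl' _ w0 w) => u u1 u2.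
    exact: gr.
- move=> t tT; rewrite gr; last lra.
  by rewrite -addrA -scalerDl; congr (_ + _ *: _); lra.
- by rewrite szs.
- rewrite us andbT; apply/negP => /cs[+ _].
  by move=> /nbhs_singleton; rewrite /= in_itv /= ltxx andbF.
- move=> t; rewrite inE => /orP[/eqP->|/cs tc].
    split; first by apply/near_dist; exists e.
    exists i0, j0; have gT : gam' T = q by rewrite gr // subrr scale0r addr0.
    rewrite gT; split=> //; first exact/wall_rdot.
    rewrite (@left_velocityE _ _ e v) // => [|h h1 h2].
      by rewrite inner_normal // mulf_neq0 // invr_neq0 // sqrtr_eq0 -ltNge.
    by rewrite gT gl'; [congr (_ + _ *: _)| |]; lra.
  have tT : t < T.
    by case: (tc) => /nbhs_singleton; rewrite /= in_itv /= => /andP[].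
  apply: collisions_local tc.
    by move=> u; rewrite /= !in_itv /= => /andP[-> u2] /=; lra.
  exact: near_gl.
Qed.

Lemma reach_collisions N T q v : reach N T q v -> has_trajectory_with_collisions R n d N.
Proof.
move=> [gam [s [_ [_ _ [_ tr] _ [szs us cs]]]]].
exists [set` `[0, T[], gam; split=> //.
have inj : {in `I_N &, injective (nth 0 s)}.
  move=> a b; rewrite !inE /= => aN bN /eqP.
  by rewrite nth_uniq ?szs // => /eqP.
rewrite -(card_le_eql (inj_card_eq (A := `I_N) inj)).
apply: subset_card_le => _ [a /= aN <-].
by apply: cs; rewrite mem_nth ?szs.
Qed.

End Flights.

(** * Limits at zero from the right *)

Section Tends.
Variable R : realType.
Implicit Types (f g : R -> R) (a b l : R).

Definition tends f l := f @ 0^'+ --> l.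

Lemma tends_cst a : tends (fun=> a) a.
Proof. exact: cvg_cst. Qed.

Lemma tendsD f g a b : tends f a -> tends g b -> tends (fun x => f x + g x) (a + b).
Proof. exact: cvgD. Qed.

Lemma tendsB f g a b : tends f a -> tends g b -> tends (fun x => f x - g x) (a - b).
Proof. exact: cvgB. Qed.

Lemma tendsM f g a b : tends f a -> tends g b -> tends (fun x => f x * g x) (a * b).
Proof. exact: cvgM. Qed.

Lemma tendsV f a : a != 0 -> tends f a -> tends (fun x => (f x)^-1) a^-1.
Proof. exact: cvgV. Qed.

Lemma tends_sqrt f a : tends f a -> tends (fun x => Num.sqrt (f x)) (Num.sqrt a).
Proof. by move=> fa; apply: continuous_cvg => //; exact: sqrt_continuous. Qed.

Lemma tends_sum (I : Type) (r : seq I) (F : I -> R -> R) (l : I -> R) :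
  (forall i, tends (F i) (l i)) ->
  tends (fun x => \sum_(i <- r) F i x) (\sum_(i <- r) l i).
Proof.
move=> h; elim: r => [|i r IH].
  rewrite big_nil; under eq_fun do rewrite big_nil.
  exact: tends_cst.
rewrite big_cons; under eq_fun do rewrite big_cons.
exact: tendsD.
Qed.

Lemma tends_pow k : tends (fun x => x ^+ k.+1) 0.
Proof.
have -> : 0 = 0 ^+ k.+1 :> R by rewrite expr0n.
by apply: cvg_at_right_filter; exact: exprn_continuous.
Qed.

Lemma tends_pow0 k : tends (fun x => x ^+ k) (0 ^+ k).
Proof. by apply: cvg_at_right_filter; exact: exprn_continuous. Qed.

Lemma near0_gt0 (P : R -> Prop) :
  (forall x, 0 < x -> P x) -> \forall x \near 0^'+, P x.
Proof.
move=> h; near=> x; apply: h; near: x; exact: nbhs_right_gt.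
Unshelve. all: by end_near. Qed.

Lemma tends_near f g l l' : (\forall x \near 0^'+, f x = g x) -> l = l' ->
  tends f l -> tends g l'.
Proof. by move=> fg <-; apply: cvg_trans; exact: near_eq_cvg. Qed.

Lemma tends_ext f g l l' : (forall x, 0 < x -> f x = g x) -> l = l' ->
  tends f l -> tends g l'.
Proof. by move=> fg; apply: tends_near; exact: near0_gt0. Qed.

Lemma tends_gt f a l : tends f l -> a < l -> \forall x \near 0^'+, a < f x.
Proof. by move=> fl al; apply: (cvgr_gt _ fl). Qed.

Lemma tends_lt f a l : tends f l -> l < a -> \forall x \near 0^'+, f x < a.
Proof. by move=> fl al; apply: (cvgr_lt _ fl). Qed.

(** The smaller root [t = 2 X / (D - U)] of [X + U t + K t ^+ 2] when [U < 0] and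
    [D] is the square root of the discriminant: in this form it has a limit as
    [K] tends to [0]. *)
Lemma first_root (X U K t : R) : 0 < X -> U < 0 -> 0 <= K ->
    4 * K * X < U ^+ 2 ->
    t = 2 * X / (Num.sqrt (U ^+ 2 - 4 * K * X) - U) ->
  [/\ 0 < t, X + U * t + K * t ^+ 2 = 0, U + 2 * K * t < 0 &
      forall s, 0 <= s -> s < t -> 0 < X + U * s + K * s ^+ 2].
Proof.
move=> X0 U0 K0 disc tE; set D := Num.sqrt _ in tE.
have D0 : 0 < D by rewrite sqrtr_gt0; lra.
have D2 : D ^+ 2 = U ^+ 2 - 4 * K * X by rewrite sqr_sqrtr //; lra.
have DU : 0 < D - U by lra.
have t0 : 0 < t by rewrite tE divr_gt0 // mulr_gt0.
have Xt : X = t * (D - U) / 2 by rewrite tE; field; lra.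
have Kt : 2 * K * t = - (U + D).
  apply: (mulIf (lt0r_neq0 DU)).
  have -> : 2 * K * t * (D - U) = 4 * K * X by rewrite Xt; field.
  by move: D2; lra.
have root : X + U * t + K * t ^+ 2 = 0.
  have -> : K * t ^+ 2 = (2 * K * t) * t / 2 by field.
  by rewrite Kt Xt; field.
split=> //; first by rewrite Kt; lra.
move=> s s0 st.
have -> : X + U * s + K * s ^+ 2 =
    (t - s) * (D + (t - s) * K) + (X + U * t + K * t ^+ 2)
    + (t - s) * (- (U + D) - 2 * K * t) by ring.
rewrite root Kt subrr mulr0 !addr0 mulr_gt0 ?subr_gt0 //.
by rewrite ltr_pwDl // mulr_ge0 //; lra.
Qed.

End Tends.

Arguments tends_cst {R} a.
Arguments tends_pow {R} k.
Arguments tends_pow0 {R} k.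

(** * Trees of contacts and their shadows

    The edges of the tree are the contacts. All objects depend on the small
    parameter [x]; a shadow of a family of states, as [x] tends to [0], is the list
    [X] of the rescaled gaps and the list [S] of the rescaled speeds at the edges. *)

Section ContactTree.
Variables (R : realType) (n m d : nat) (src tgt : 'I_m -> 'I_n) (cpl : rel 'I_m).
Implicit Types (e f : 'I_m) (i j k : 'I_n) (q v : R -> 'M[R]_(n, d)).

Definition incidence e k : R := (k == tgt e)%:R - (k == src e)%:R.

(** [overlap e f * edge_dot q e f] is twice the scalar product of the unit normals
    of the walls [e] and [f] when the balls of [e] and those of [f] touch: the
    factor [overlap e f] is [1] or [-1] if the edges share one ball, [2] if they
    are equal, [0] if they are disjoint. *)
Definition overlap e f : R := incidence e (tgt f) - incidence e (src f).

Definition edge_dot (q : 'M[R]_(n, d)) e f :=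
  \sum_a (q (tgt e) a - q (src e) a) * (q (tgt f) a - q (src f) a).

(** [Q x] is the configuration of touching balls for the parameter [x]. The
    coefficients [path i f] describe the path of the tree that leads to the ball
    [i]: by [ct_path], prescribing a vector for each edge and summing along the
    paths solves the equations between neighbours. *)
Record contact_tree (Q : R -> 'M[R]_(n, d)) (Q0 : 'M[R]_(n, d))
    (path : 'I_n -> 'I_m -> R) : Prop := ContactTree {
  ct_ord : forall e, (src e < tgt e)%N;
  ct_lim : forall i a, tends (fun x => Q x i a) (Q0 i a);
  ct_unit : \forall x \near 0^'+, forall e, rdot (Q x) (Q x) (src e) (tgt e) = 1;
  ct_apart : forall i j, (i < j)%N -> (forall e, (i, j) <> (src e, tgt e)) ->
    1 < rdot Q0 Q0 i j;
  ct_dot : \forall x \near 0^'+, forall e f, (e < f)%N ->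
    overlap e f * edge_dot (Q x) e f = if cpl e f then - 2 * x ^+ (f - e) else 0;
  ct_path : forall e f, path (tgt e) f - path (src e) f = (e == f)%:R
}.

Arguments ct_lim [Q Q0 path] _ i a.

Variables (Q : R -> 'M[R]_(n, d)) (Q0 : 'M[R]_(n, d)) (path : 'I_n -> 'I_m -> R).
Hypothesis tree : contact_tree Q Q0 path.

(** The unit of length, and of time since speeds do not tend to infinity. It is
    small compared with [x ^+ e] for every edge [e], so that the spheres look flat,
    and with [x ^+ m.+1], so that the directions of the contacts are those of [Q x]
    up to an error that remains negligible after division by any [x ^+ e]. *)
Definition scale (x : R) := x ^+ m.+1 * x ^+ m.+1.

Record shadows (X S : 'I_m -> R) q v : Prop := Shadows {
  sh_pos : forall i a, tends (fun x => (q x i a - Q x i a) / x ^+ m.+1) 0;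
  sh_vel : forall i a, exists l, tends (fun x => v x i a) l;
  sh_gap : forall e, tends (fun x =>
    (rdot (q x) (q x) (src e) (tgt e) - 1) / (2 * scale x * x ^+ e)) (X e);
  sh_speed : forall e, tends (fun x => rdot (q x) (v x) (src e) (tgt e) / x ^+ e) (S e)
}.

Lemma pow_split e (x : R) : x ^+ m.+1 = x ^+ e * x ^+ (m - e).+1.
Proof. by rewrite -exprD; congr (_ ^+ _); have := ltn_ord e; lia. Qed.

Lemma shadows_pos X S q v : shadows X S q v ->
  forall i a, tends (fun x => q x i a) (Q0 i a).
Proof.
move=> sh i a; have := tendsM (sh_pos sh i a) (tends_pow m).
move=> /(tendsD (ct_lim tree i a)); apply: tends_ext; last by rewrite mulr0 addr0.
by move=> x x0; rewrite divfK ?expf_neq0 ?lt0r_neq0 // addrC subrK.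
Qed.

Arguments shadows_pos [X S q v] _ i a.

Lemma shadows_vel X S q v : shadows X S q v ->
  exists w : 'I_n -> 'I_d -> R, forall i a, tends (fun x => v x i a) (w i a).
Proof.
case=> _ vel _ _; exists (fun i a => projT1 (cid (vel i a))) => i a.
exact: projT2 (cid (vel i a)).
Qed.

Lemma shadows_rdot X S q v : shadows X S q v -> forall i j,
  [/\ tends (fun x => rdot (q x) (q x) i j) (rdot Q0 Q0 i j),
      exists l, tends (fun x => rdot (q x) (v x) i j) l &
      exists l, tends (fun x => rdot (v x) (v x) i j) l].
Proof.
move=> sh i j; have qQ0 := shadows_pos sh; have [w vw] := shadows_vel sh.
split.
- by apply: tends_sum => a; apply: tendsM; apply: tendsB.
- exists (\sum_a (Q0 i a - Q0 j a) * (w i a - w j a)).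
  by apply: tends_sum => a; apply: tendsM; apply: tendsB.
- exists (\sum_a (w i a - w j a) * (w i a - w j a)).
  by apply: tends_sum => a; apply: tendsM; apply: tendsB.
Qed.

Lemma shadows_drift X S q v (t : R -> R) t0 : shadows X S q v -> tends t t0 ->
  shadows (fun e => X e + t0 * S e) S (fun x => q x + (scale x * t x) *: v x) v.
Proof.
move=> sh tt0; have [pos vel gap speed] := sh.
have [w vw] := shadows_vel sh.
split=> // [i a|e|e].
- have := tendsD (pos i a) (tendsM (tends_pow m) (tendsM tt0 (vw i a))).
  apply: tends_ext => [x x0|]; last by rewrite mul0r addr0.
  have : x ^+ m.+1 != 0 by rewrite expf_neq0 ?lt0r_neq0.
  by rewrite !mxE /scale; move: (x ^+ m.+1) => c c0; field.
- have [_ _ [l vv]] := shadows_rdot sh (src e) (tgt e).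
  have := tendsD (tendsD (gap e) (tendsM tt0 (speed e)))
    (tendsM (tendsM (tendsM tt0 tt0) vv)
            (tendsM (tends_pow m) (tendsM (tends_pow (m - e)) (tends_cst 2^-1)))).
  apply: tends_ext => [x x0|]; last by rewrite !mul0r mulr0 addr0.
  have : x ^+ e != 0 by rewrite expf_neq0 ?lt0r_neq0.
  have : x ^+ (m - e).+1 != 0 by rewrite expf_neq0 ?lt0r_neq0.
  rewrite rdot_line /scale !(pow_split e).
  move: (x ^+ e) (x ^+ (m - e).+1) => b c c0 b0; field.
  by rewrite b0 c0.
- have [_ _ [l vv]] := shadows_rdot sh (src e) (tgt e).
  have := tendsD (speed e) (tendsM (tendsM tt0 vv)
            (tendsM (tends_pow m) (tends_pow (m - e)))).
  apply: tends_ext => [x x0|]; last by rewrite !mulr0 addr0.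
  have : x ^+ e != 0 by rewrite expf_neq0 ?lt0r_neq0.
  rewrite rdot_linel /scale !(pow_split e).
  by move: (x ^+ e) (x ^+ (m - e).+1) => b c b0; field.
Qed.

Lemma overlapC e f : overlap e f = overlap f e.
Proof.
by rewrite /overlap /incidence (eq_sym (tgt f)) (eq_sym (src f) (src e))
  (eq_sym (tgt f)) (eq_sym (src f)); ring.
Qed.

Lemma edge_dotC (p : 'M[R]_(n, d)) e f : edge_dot p e f = edge_dot p f e.
Proof. by apply: eq_bigr => a _; rewrite mulrC. Qed.

Lemma overlap_id e : overlap e e = 2.
Proof.
have /negPf ne : src e != tgt e by rewrite neq_ltn (ct_ord tree).
by rewrite /overlap /incidence !eqxx ne eq_sym ne /=; ring.
Qed.

Lemma edge_dot_id (p : 'M[R]_(n, d)) e : edge_dot p e e = rdot p p (src e) (tgt e).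
Proof. by rewrite rdotC. Qed.

Lemma rdot_bounce (p w : 'M[R]_(n, d)) e f :
  rdot p (bounce (src e) (tgt e) p w) (src f) (tgt f) =
  rdot p w (src f) (tgt f) -
    rdot p w (src e) (tgt e) * (overlap e f * edge_dot p e f).
Proof.
rewrite [rdot p (bounce _ _ _ _) _ _]/rdot.
under eq_bigr do rewrite !bounceE ?(ct_ord tree) //.
rewrite /edge_dot !mulr_sumr /overlap /incidence; set r := rdot p w (src e) _.
rewrite [rdot _ _ _ _]/rdot -sumrB; apply: eq_bigr => a _.
by ring.
Qed.

(** The effect of a hit of [e] on the rescaled speeds in the limit. *)
Definition kicked e (S : 'I_m -> R) f :=
  if f == e then - S e else if (e < f)%N && cpl e f then S f + 2 * S e else S f.

Lemma shadows_edge_dot X S q v e f : shadows X S q v ->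
  tends (fun x => (edge_dot (q x) e f - edge_dot (Q x) e f) / x ^+ m.+1) 0.
Proof.
move=> sh; have [pos _ _ _] := sh; have qQ0 := shadows_pos sh.
have := tends_sum (r := index_enum 'I_d) (fun a =>
  tendsD (tendsM (tendsB (pos (tgt e) a) (pos (src e) a))
                 (tendsB (qQ0 (tgt f) a) (qQ0 (src f) a)))
         (tendsM (tendsB (ct_lim tree (tgt e) a) (ct_lim tree (src e) a))
                 (tendsB (pos (tgt f) a) (pos (src f) a)))).
apply: tends_ext => [x x0|]; last first.
  by rewrite big1 // => a _; rewrite !subrr mul0r mulr0 addr0.
rewrite -sumrB mulr_suml; apply: eq_bigr => a _.
have : x ^+ m.+1 != 0 by rewrite expf_neq0 ?lt0r_neq0.
by move: (x ^+ m.+1) => c c0; field.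
Qed.

(** The factor by which a hit of [e] acts on the rescaled speed at [f]. For
    [e < f] the small scalar product and the ratio of the speeds compensate each
    other; for [f < e] they are both small. *)
Lemma tree_coupling e f : tends
  (fun x => overlap e f * edge_dot (Q x) e f * x ^+ e / x ^+ f)
  (if e == f then 2 else if (e < f)%N && cpl e f then - 2 else 0).
Proof.
have [->|ne] := eqVneq e f.
  apply: tends_near (tends_cst (2 : R)) => //; near=> x.
  have x0 : 0 < x by near: x; exact: nbhs_right_gt.
  rewrite overlap_id edge_dot_id.
  have -> : rdot (Q x) (Q x) (src f) (tgt f) = 1 by near: x; apply: filterS (ct_unit tree).
  by rewrite mulr1 mulfK // expf_neq0 // lt0r_neq0.
have [lef|lfe|/val_inj eef] := ltngtP e f; last by rewrite eef eqxx in ne.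
- apply: tends_near (tends_cst _) => //; near=> x.
  have x0 : 0 < x by near: x; exact: nbhs_right_gt.
  have -> : overlap e f * edge_dot (Q x) e f = if cpl e f then - 2 * x ^+ (f - e) else 0.
    by near: x; apply: filterS (ct_dot tree) => x; apply.
  rewrite /=; case: (cpl e f); last by rewrite !mul0r.
  have -> : x ^+ f = x ^+ (f - e) * x ^+ e by rewrite -exprD subnK // ltnW.
  have : x ^+ (f - e) != 0 by rewrite expf_neq0 // lt0r_neq0.
  have : x ^+ e != 0 by rewrite expf_neq0 // lt0r_neq0.
  move: (x ^+ e) (x ^+ (f - e)) => b c b0 c0; field.
  by rewrite b0 c0.
- have := tendsM (tends_cst (if cpl f e then - 2 else 0 : R)) (tendsM (tends_pow (e - f).-1)
    (tends_pow (e - f).-1)).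
  apply: tends_near; last by rewrite /= !mulr0.
  near=> x.
  have x0 : 0 < x by near: x; exact: nbhs_right_gt.
  rewrite overlapC edge_dotC.
  have -> : overlap f e * edge_dot (Q x) f e = if cpl f e then - 2 * x ^+ (e - f) else 0.
    by near: x; apply: filterS (ct_dot tree) => x; apply.
  rewrite prednK ?subn_gt0 //.
  have -> : x ^+ e = x ^+ (e - f) * x ^+ f by rewrite -exprD subnK // ltnW.
  have : x ^+ f != 0 by rewrite expf_neq0 // lt0r_neq0.
  by move: (x ^+ f) => c c0; case: (cpl f e); field.
Unshelve. all: by end_near. Qed.

Lemma shadows_bounce X S q v e : shadows X S q v ->
  shadows X (kicked e S) q (fun x => bounce (src e) (tgt e) (q x) (v x)).
Proof.
move=> sh; have [pos vel gap speed] := sh; have qQ0 := shadows_pos sh.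
split=> // [k a|f].
  have [l vl] := vel k a.
  exists (l - (S e * 0 ^+ e) * ((k == src e)%:R - (k == tgt e)%:R)
     * (Q0 (src e) a - Q0 (tgt e) a)).
  have := tendsB vl (tendsM (tendsM (tendsM (speed e) (tends_pow0 e))
     (tends_cst ((k == src e)%:R - (k == tgt e)%:R)))
     (tendsB (qQ0 (src e) a) (qQ0 (tgt e) a))).
  apply: tends_ext => // x x0; rewrite bounceE ?(ct_ord tree) //.
  by rewrite divfK // expf_neq0 // lt0r_neq0.
have := tendsB (speed f) (tendsM (speed e) (tendsD (@tree_coupling e f)
  (tendsM (tends_cst (overlap e f)) (tendsM (@shadows_edge_dot X S q v e f sh)
    (tendsM (tends_pow (m - f)) (tends_pow0 e)))))).
apply: tends_ext => [x x0|]; last first.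
  rewrite mul0r mulr0 addr0 /kicked eq_sym.
  by have [->|ne] := eqVneq f e; [|case: ifP => _]; ring.
rewrite rdot_bounce (pow_split f).
have : x ^+ e != 0 by rewrite expf_neq0 ?lt0r_neq0.
have : x ^+ f != 0 by rewrite expf_neq0 ?lt0r_neq0.
have : x ^+ (m - f).+1 != 0 by rewrite expf_neq0 ?lt0r_neq0.
move: (x ^+ e) (x ^+ f) (x ^+ (m - f).+1) => a b c c0 b0 a0; field.
by rewrite a0 b0 c0.
Qed.


Lemma tends_scale : tends scale 0.
Proof.
have := tendsM (@tends_pow R m) (@tends_pow R m).
by apply: tends_ext; rewrite ?mulr0.
Qed.

Lemma scale_gt0 x : 0 < x -> 0 < scale x.
Proof. by move=> x0; rewrite mulr_gt0 // exprn_gt0. Qed.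

(** A quadratic with a nonnegative leading coefficient lies above its tangent at
    [0], and a linear function is positive between two points where it is. *)
Lemma rdot_line_gt1 (p w : 'M[R]_(n, d)) (t s : R) i j : 0 <= s -> s <= t ->
  1 < rdot p p i j -> 1 < rdot p p i j + 2 * t * rdot p w i j ->
  1 < rdot (p + s *: w) (p + s *: w) i j.
Proof.
move=> s0 st h0 ht; rewrite rdot_line.
have [->|s1] := eqVneq s 0; first by nra.
have sp : 0 < s by rewrite lt_neqAle eq_sym s1.
have := rdot_ge0 w i j; set A := rdot p p i j in h0 ht *.
set B := rdot p w i j in ht *; set C := rdot w w i j => C0.
have C1 : 0 <= s ^+ 2 * C by rewrite mulr_ge0 // sqr_ge0.
have [B0|B0] := leP 0 B; first by have := mulr_ge0 s0 B0; nra.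
by have : 2 * t * B <= 2 * s * B; nra.
Qed.

(** No contact during a free flight: positivity at the two ends of the limiting
    flight suffices, separately for each edge, and the balls that are not
    neighbours are kept apart by [ct_apart]. *)
Lemma segment_apart X S q v (t : R -> R) (t0 : R) (P : pred 'I_m) :
  shadows X S q v -> tends t t0 ->
  (forall f, P f -> 0 < X f) -> (forall f, P f -> 0 < X f + t0 * S f) ->
  \forall x \near 0^'+, forall i j (s : R), (i < j)%N ->
    (forall f, (i, j) = (src f, tgt f) -> P f) -> 0 <= s -> s <= scale x * t x ->
    1 < rdot (q x + s *: v x) (q x + s *: v x) i j.
Proof.
move=> sh tt0 Xp Xtp; have [_ _ gap speed] := sh.
suff H : \forall x \near 0^'+, forall i j, (i < j)%N ->
    (forall f, (i, j) = (src f, tgt f) -> P f) ->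
    1 < rdot (q x) (q x) i j /\
    1 < rdot (q x) (q x) i j + 2 * (scale x * t x) * rdot (q x) (v x) i j.
  apply: filterS H => x H i j s lij Pf s0 st; have [h1 h2] := H i j lij Pf.
  exact: rdot_line_gt1 st h1 h2.
apply: filter_forall => i; apply: filter_forall => j.
case: (pselect (exists f, (i, j) = (src f, tgt f))) => [[f [-> ->]]|nf].
  have [Pf|nPf] := boolP (P f); last first.
    by apply: near0_gt0 => x _ _ /(_ f erefl); rewrite (negPf nPf).
  have h1 := tends_gt (gap f) (Xp f Pf).
  have h2 := tends_gt (tendsD (gap f) (tendsM tt0 (speed f))) (Xtp f Pf).
  near=> x => _ _.
  have x0 : 0 < x by near: x; exact: nbhs_right_gt.
  have xf0 : 0 < x ^+ f by rewrite exprn_gt0.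
  have sc0 := scale_gt0 x0.
  have D0 : 0 < 2 * scale x * x ^+ f by rewrite mulr_gt0 // mulr_gt0.
  have g1 : 0 < (rdot (q x) (q x) (src f) (tgt f) - 1) / (2 * scale x * x ^+ f).
    by near: x.
  have g2 : 0 < (rdot (q x) (q x) (src f) (tgt f) - 1) / (2 * scale x * x ^+ f) +
      t x * (rdot (q x) (v x) (src f) (tgt f) / x ^+ f) by near: x.
  split; first by move: g1; rewrite pmulr_lgt0 ?invr_gt0 // subr_gt0.
  have := mulr_gt0 g2 D0; set A := rdot _ _ _ _; set B := rdot _ _ _ _.
  suff -> : ((A - 1) / (2 * scale x * x ^+ f) + t x * (B / x ^+ f)) *
    (2 * scale x * x ^+ f) = A - 1 + 2 * (scale x * t x) * B by lra.
  by field; rewrite !lt0r_neq0.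
have [lij|_] := boolP (i < j)%N; last by apply: near0_gt0.
have [qq [l qv] _] := shadows_rdot sh i j.
have lim1 : 1 < rdot Q0 Q0 i j by apply: (ct_apart tree) => // f fE; apply: nf; exists f.
have h1 := tends_gt qq lim1.
have h2 : \forall x \near 0^'+,
    1 < rdot (q x) (q x) i j + 2 * (scale x * t x) * rdot (q x) (v x) i j.
  apply: (@tends_gt _ _ _ (rdot Q0 Q0 i j)) lim1.
  have := tendsD qq (tendsM (tendsM (tends_cst (2 : R)) (tendsM tends_scale tt0)) qv).
  by apply: tends_ext; rewrite // mul0r mulr0 mul0r addr0.
by apply: filterS2 h1 h2 => x a b _ _.
Unshelve. all: by end_near. Qed.

Lemma reach_time N (T : R) (p w : 'M[R]_(n, d)) : reach N T p w -> 0 <= T.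
Proof. by move=> [? [? [? []]]]. Qed.

Definition shadow_reach N X S := exists q v (T : R -> R), shadows X S q v /\
  \forall x \near 0^'+, reach N (T x) (q x) (v x).

(** A transversal hit in the limit is a collision of the true trajectories. The
    true hit takes place at the first root [t x] of the gap at [e], which tends to
    the moment [X e] of the hit in the limit; the flight then goes on for [sg]. *)
Lemma shadow_reach_hit N X S e (sg : R) :
  shadow_reach N X S -> (forall f, 0 < X f) -> S e = -1 ->
  (forall f, f != e -> 0 < X f + X e * S f) -> 0 < sg ->
  (forall f, f != e -> 0 < X f + X e * S f + sg * kicked e S f) ->
  shadow_reach N.+1 (fun f => X f + X e * S f + sg * kicked e S f) (kicked e S).
Proof.
move=> [q [v [T [sh rch]]]] X0 Se Xhit sg0 Xend.
have [pos vel gap speed] := sh.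
pose Xe x := (rdot (q x) (q x) (src e) (tgt e) - 1) / (2 * scale x * x ^+ e).
pose U x := rdot (q x) (v x) (src e) (tgt e) / x ^+ e.
pose K x := scale x * rdot (v x) (v x) (src e) (tgt e) / (2 * x ^+ e).
pose t x := 2 * Xe x / (Num.sqrt (U x ^+ 2 - 4 * K x * Xe x) - U x).
have XeE : tends Xe (X e) by exact: gap.
have UE : tends U (-1) by rewrite -Se; exact: speed.
have KE : tends K 0.
  have [_ _ [l vv]] := shadows_rdot sh (src e) (tgt e).
  have := tendsM (tendsM (tends_pow m) (tends_pow (m - e))) (tendsM vv (tends_cst 2^-1)).
  apply: tends_ext => [x x0|]; last by rewrite !mul0r.
  have : x ^+ e != 0 by rewrite expf_neq0 ?lt0r_neq0.
  rewrite /K /scale !(pow_split e).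
  by move: (x ^+ e) (x ^+ (m - e).+1) => b c b0; field.
have discE : tends (fun x => U x ^+ 2 - 4 * K x * Xe x) 1.
  apply: (tends_ext _ _ (tendsB (tendsM UE UE)
    (tendsM (tendsM (tends_cst (4 : R)) KE) XeE))) => [x _|]; last by ring.
  by rewrite expr2.
have tE : tends t (X e).
  have nz : Num.sqrt 1 - - 1 != 0 :> R by rewrite sqrtr1 lt0r_neq0 //; lra.
  apply: (tends_ext _ _ (tendsM (tendsM (tends_cst (2 : R)) XeE)
    (tendsV nz (tendsB (tends_sqrt discE) UE)))) => //.
  by rewrite sqrtr1; field.
pose p x := q x + (scale x * t x) *: v x.
pose v' x := bounce (src e) (tgt e) (p x) (v x).
have shp : shadows (fun f => X f + X e * S f) S p v := shadows_drift sh tE.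
have shp' : shadows (fun f => X f + X e * S f) (kicked e S) p v' := shadows_bounce e shp.
exists (fun x => p x + (scale x * sg) *: v' x), v', (fun x => T x + scale x * t x + scale x * sg).
split; first exact: shadows_drift shp' (tends_cst sg).
have near1 := segment_apart (P := predC1 e) sh tE (fun f _ => X0 f) Xhit.
have near2 := segment_apart (P := predC1 e) shp' (tends_cst sg) Xhit Xend.
have disc0 : \forall x \near 0^'+, 0 < U x ^+ 2 - 4 * K x * Xe x.
  exact: tends_gt discE ltr01.
have U0 : \forall x \near 0^'+, U x < 0 by apply: tends_lt UE _; rewrite oppr_lt0.
have Xe0 := tends_gt XeE (X0 e).
near=> x.
have x0 : 0 < x by near: x; exact: nbhs_right_gt.
have xe0 : 0 < x ^+ e by rewrite exprn_gt0.
have sc0 := scale_gt0 x0.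
have K0 : 0 <= K x.
  apply: divr_ge0; last by rewrite mulr_ge0 // ltW.
  by apply: mulr_ge0; [exact: ltW|exact: rdot_ge0].
have Xx0 : 0 < Xe x by near: x.
have Ux0 : U x < 0 by near: x.
have disc : 4 * K x * Xe x < U x ^+ 2 by rewrite -subr_gt0; near: x.
have [t0 root slope before] := first_root Xx0 Ux0 K0 disc (erefl (t x)).
have gapE s : rdot (q x + (scale x * s) *: v x) (q x + (scale x * s) *: v x) (src e) (tgt e) =
    1 + 2 * scale x * x ^+ e * (Xe x + U x * s + K x * s ^+ 2).
  by rewrite rdot_line /Xe /U /K; field; rewrite !lt0r_neq0.
have edgeP i j : (i, j) = (src e, tgt e) \/ (forall f, (i, j) = (src f, tgt f) -> predC1 e f).
  case: (pselect ((i, j) = (src e, tgt e))) => [|ne]; first by left.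
  by right=> f fE /=; apply/eqP => fe; rewrite fE fe in ne.
have pe : rdot (p x) (p x) (src e) (tgt e) = 1 by rewrite gapE root mulr0 addr0.
have pve : rdot (p x) (v x) (src e) (tgt e) < 0.
  have -> : rdot (p x) (v x) (src e) (tgt e) = x ^+ e * (U x + 2 * K x * t x).
    by rewrite rdot_linel /U /K; field; rewrite !lt0r_neq0.
  by rewrite pmulr_rlt0.
have pv'e : rdot (p x) (v' x) (src e) (tgt e) = - rdot (p x) (v x) (src e) (tgt e).
  by rewrite rdot_bounce overlap_id edge_dot_id pe; ring.
have N1 : forall i j (s : R), (i < j)%N ->
    (forall f, (i, j) = (src f, tgt f) -> predC1 e f) -> 0 <= s ->
    s <= scale x * t x -> 1 < rdot (q x + s *: v x) (q x + s *: v x) i j by near: x.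
have N2 : forall i j (s : R), (i < j)%N ->
    (forall f, (i, j) = (src f, tgt f) -> predC1 e f) -> 0 <= s ->
    s <= scale x * sg -> 1 < rdot (p x + s *: v' x) (p x + s *: v' x) i j by near: x.
have rx : reach N (T x) (q x) (v x) by near: x.
have st0 : 0 < scale x * t x by apply: mulr_gt0.
have ssg0 : 0 < scale x * sg by apply: mulr_gt0.
have T0 := reach_time rx.
apply: reach_bounce => //.
- by lra.
- apply: reach_drift => // s s0 s1 i j lij.
  have [[-> ->]|ne] := edgeP i j; last by apply: N1 => //; exact: ltW.
  have -> : s = scale x * (s / scale x) by field; rewrite lt0r_neq0.
  rewrite gapE ltrDl mulr_gt0 //; first by rewrite mulr_gt0 // mulr_gt0.
  apply: before; first by rewrite divr_ge0 // ltW.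
  by rewrite ltr_pdivrMr // mulrC.
- exact: ct_ord tree e.
- by rewrite lt_eqF.
- move=> i j lij ne; have [//|ne'] := edgeP i j.
  by apply: N1 => //; exact: ltW.
- move=> s s0 s1 i j lij; have [[-> ->]|ne] := edgeP i j; last first.
    by apply: N2 => //; exact: ltW.
  rewrite rdot_line pe pv'e.
  have := mulr_ge0 (sqr_ge0 s) (rdot_ge0 (v' x) (src e) (tgt e)).
  by have : 0 < s * (- rdot (p x) (v x) (src e) (tgt e)); [rewrite mulr_gt0 // oppr_gt0|lra].
Unshelve. all: by end_near. Qed.

(** Every shadow occurs: the edge vectors of [Q x] are stretched to create the gaps
    and used as directions of the relative velocities. *)
Lemma shadow_reach0 X S : shadow_reach 0 X S.
Proof.
pose W x f a := Q x (tgt f) a - Q x (src f) a.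
pose q x : 'M[R]_(n, d) := \matrix_(i, a)
  (Q x i a + \sum_f path i f * (scale x * x ^+ f * X f * W x f a)).
pose v x : 'M[R]_(n, d) := \matrix_(i, a) \sum_f path i f * (x ^+ f * S f * W x f a).
have sumP (c : 'I_m -> R) f :
    \sum_g path (tgt f) g * c g - \sum_g path (src f) g * c g = c f.
  rewrite -sumrB (bigD1 f) //= big1 ?addr0 => [|g ne]; rewrite -mulrBl (ct_path tree).
    by rewrite eqxx mul1r.
  by rewrite eq_sym (negPf ne) mul0r.
have qE x f a : q x (tgt f) a - q x (src f) a = (1 + scale x * x ^+ f * X f) * W x f a.
  by rewrite !mxE opprD addrACA sumP /W; ring.
have vE x f a : v x (tgt f) a - v x (src f) a = x ^+ f * S f * W x f a.
  by rewrite !mxE sumP.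
have WE f a : tends (fun x => W x f a) (Q0 (tgt f) a - Q0 (src f) a).
  by apply: tendsB; apply: (ct_lim tree).
have WW x f : rdot (Q x) (Q x) (src f) (tgt f) = 1 -> \sum_a W x f a * W x f a = 1.
  by rewrite rdotC.
exists q, v, (fun=> 0); split; last by apply: near0_gt0 => x _; exact: reach0.
split=> [i a|i a|f|f].
- have := tendsM (@tends_pow R m) (tends_sum (r := index_enum 'I_m) (fun f =>
    tendsM (tends_cst (path i f)) (tendsM (tendsM (tends_pow0 f) (tends_cst (X f))) (WE f a)))).
  apply: tends_ext => [x x0|]; last by rewrite mul0r.
  have : x ^+ m.+1 != 0 by rewrite expf_neq0 ?lt0r_neq0.
  rewrite mxE addrAC subrr add0r /scale; move: (x ^+ m.+1) => c c0.
  rewrite mulr_sumr mulr_suml; apply: eq_bigr => f _.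
  by field.
- eexists; have := tends_sum (r := index_enum 'I_m) (fun f =>
    tendsM (tends_cst (path i f)) (tendsM (tendsM (tends_pow0 f) (tends_cst (S f))) (WE f a))).
  by apply: tends_ext => // x x0; rewrite mxE.
- have := tendsD (tends_cst (X f)) (tendsM (tendsM tends_scale (tends_pow0 f))
    (tends_cst (X f ^+ 2 / 2))).
  apply: tends_near; last by rewrite !mul0r addr0.
  near=> x.
  have x0 : 0 < x by near: x; exact: nbhs_right_gt.
  have u1 : \sum_a W x f a * W x f a = 1.
    by apply: WW; near: x; apply: filterS (ct_unit tree) => x; apply.
  have -> : rdot (q x) (q x) (src f) (tgt f) = (1 + scale x * x ^+ f * X f) ^+ 2.
    rewrite rdotC -[RHS]mulr1 -[X in _ = _ * X]u1 mulr_sumr; apply: eq_bigr => a _.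
    by rewrite qE; ring.
  have : scale x != 0 by rewrite lt0r_neq0 // scale_gt0.
  have : x ^+ f != 0 by rewrite expf_neq0 // lt0r_neq0.
  move: (x ^+ f) (scale x) => b c b0 c0; field.
  by rewrite b0 c0.
- have := tendsM (tendsD (tends_cst 1) (tendsM (tendsM tends_scale (tends_pow0 f))
    (tends_cst (X f)))) (tends_cst (S f)).
  apply: tends_near; last by rewrite !mul0r addr0 mul1r.
  near=> x.
  have x0 : 0 < x by near: x; exact: nbhs_right_gt.
  have u1 : \sum_a W x f a * W x f a = 1.
    by apply: WW; near: x; apply: filterS (ct_unit tree) => x; apply.
  have -> : rdot (q x) (v x) (src f) (tgt f) =
      (1 + scale x * x ^+ f * X f) * (x ^+ f * S f).
    rewrite rdotC -[RHS]mulr1 -[X in _ = _ * X]u1 mulr_sumr; apply: eq_bigr => a _.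
    by rewrite qE vE; ring.
  have : x ^+ f != 0 by rewrite expf_neq0 // lt0r_neq0.
  by move: (x ^+ f) (scale x) => b c b0; field.
Unshelve. all: by end_near. Qed.

Lemma shadow_reach_collisions N X S : shadow_reach N X S ->
  has_trajectory_with_collisions R n d N.
Proof.
move=> [q [v [T [_ h]]]].
near (0 : R)^'+ => x.
apply: (@reach_collisions _ _ _ _ (T x) (q x) (v x)).
by near: x.
Unshelve. all: by end_near. Qed.

End ContactTree.

(** * A caterpillar of balls in space

    Balls and edges are labelled by natural numbers. The edge [l] joins the ball
    [parent l] to the ball [l.+1]. The ball [0] and the odd balls are the spine; the
    ball [2 j + 1] carries the edges [2 j], [2 j + 1] and [2 j + 2], of which
    [2 j + 1] is pendant and the other two belong to the spine. *)

Definition parent (l : nat) : nat := if l is l'.+1 then (l' %/ 2 * 2).+1 else 0.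

(** The ideal positions, in the cubic lattice: the spine is a staircase in the plane
    of the first two coordinates, and the pendant balls lie alternately above and
    below it, which keeps those of consecutive spine balls at a distance. *)
Definition node_x (l : nat) : int := if l is l'.+1 then (l' %/ 4)%N%:Z else -1.
Definition node_y (l : nat) : int := if l is l'.+1 then ((l' + 2) %/ 4)%N%:Z else 0.
Definition node_z (l : nat) : int :=
  if l is l'.+1 then (l' %% 4 == 1)%N%:Z - (l' %% 4 == 3)%N%:Z else 0.

Definition dir_x (l : nat) : int := (l %% 4 == 0)%N.
Definition dir_y (l : nat) : int := (l %% 4 == 2)%N.
Definition dir_z (l : nat) : int := (l %% 4 == 1)%N%:Z - (l %% 4 == 3)%N%:Z.

Definition coupled (l l' : nat) : bool :=
  (l' == l.+1) || (l %% 2 == 0)%N && (l' == l.+2).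

Lemma parent_le l : (parent l <= l)%N.
Proof. case: l => //= l; lia. Qed.

Lemma mod4P l : exists k,
  [\/ l = (4 * k)%N, l = (4 * k + 1)%N, l = (4 * k + 2)%N | l = (4 * k + 3)%N].
Proof.
exists (l %/ 4)%N.
have : (l %% 4 < 4)%N by rewrite ltn_mod.
have := divn_eq l 4; move: (l %/ 4)%N (l %% 4)%N => k r -> h.
have : r = 0%N \/ r = 1%N \/ r = 2%N \/ r = 3%N by lia.
by case=> [->|[->|[->|->]]];
  [constructor 1|constructor 2|constructor 3|constructor 4]; lia.
Qed.

Lemma node_edge l :
  [/\ node_x l.+1 - node_x (parent l) = dir_x l,
      node_y l.+1 - node_y (parent l) = dir_y l &
      node_z l.+1 - node_z (parent l) = dir_z l].
Proof.
case: l => [|l] //; rewrite /node_x /node_y /node_z /dir_x /dir_y /dir_z /=.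
have [k [] ->] := mod4P l; split; lia.
Qed.

Lemma sum_squares_ge2 (x y z : int) :
  2 <= x + y + z \/ 2 <= x + y - z -> 2 <= x ^+ 2 + y ^+ 2 + z ^+ 2.
Proof.
have sq (t : int) : t <= t ^+ 2 /\ - t <= t ^+ 2 by rewrite expr2; split; nia.
by have := sq x; have := sq y; have := sq z; lia.
Qed.

Lemma node_far l l' : (l < l'.+1)%N -> parent l' != l ->
  2 <= (node_x l'.+1 - node_x l) ^+ 2 + (node_y l'.+1 - node_y l) ^+ 2
       + (node_z l'.+1 - node_z l) ^+ 2.
Proof.
move=> ll' /eqP pl; apply: sum_squares_ge2; move: ll' pl.
case: l' => [|l']; first by case: l.
case: l => [|l]; rewrite /parent /node_x /node_y /node_z.
  by move=> _ _; have [k []] := mod4P l'; lia.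
have [k hk] := mod4P l; have [k' hk'] := mod4P l'.
by case: hk; case: hk'; lia.
Qed.

Lemma coupled_parent l l' : (l < l')%N ->
  (parent l' == l.+1) = (l %% 2 == 0)%N && coupled l l' /\
  (parent l' == parent l) = (l %% 2 == 1)%N && coupled l l'.
Proof.
rewrite /coupled; case: l' => // l' ll'; case: l ll' => [|l] ll'; rewrite /parent.
  by split; lia.
by split; lia.
Qed.

(** The lattice is replaced by a slightly skew one, spanned by unit vectors [A],
    [B] and [C]: the first two have the coordinates [(a, b, 2 x)] and
    [(b, a, - 2 x)] with [a ^+ 2 + b ^+ 2 = 1 - 4 x ^+ 2] and [a b = 3 x ^+ 2], the
    third is [(0, 0, 1)]. Thus [A . B = 2 x ^+ 2], [A . C = 2 x] and
    [B . C = - 2 x]. The spine uses [A] and [B] alternately while the pendant edges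
    alternate between [C] and [- C], which gives the same scalar products at each
    ball of the spine. *)
Section Frame.
Variable R : realType.
Implicit Types (x p q r : R).

Definition frame_a x : R := (Num.sqrt (1 + 2 * x ^+ 2) + Num.sqrt (1 - 10 * x ^+ 2)) / 2.
Definition frame_b x : R := (Num.sqrt (1 + 2 * x ^+ 2) - Num.sqrt (1 - 10 * x ^+ 2)) / 2.

Definition skew x p q r (a : 'I_3) : R :=
  nth 0 [:: p * frame_a x + q * frame_b x; p * frame_b x + q * frame_a x;
            2 * x * (p - q) + r] a.

Lemma skew_dot x p q r p' q' r' : 10 * x ^+ 2 <= 1 ->
  \sum_a skew x p q r a * skew x p' q' r' a =
  p * p' + q * q' + r * r' + 2 * x ^+ 2 * (p * q' + q * p')
  + 2 * x * (p * r' + r * p' - q * r' - r * q').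
Proof.
move=> x1; rewrite !big_ord_recl big_ord0 /skew /= addr0.
have s1 : Num.sqrt (1 + 2 * x ^+ 2) ^+ 2 = 1 + 2 * x ^+ 2.
  by rewrite sqr_sqrtr // addr_ge0 // mulr_ge0 // sqr_ge0.
have s2 : Num.sqrt (1 - 10 * x ^+ 2) ^+ 2 = 1 - 10 * x ^+ 2.
  by rewrite sqr_sqrtr // subr_ge0.
have ab : frame_a x * frame_b x = 3 * x ^+ 2.
  by rewrite /frame_a /frame_b; move: s1 s2; move: (Num.sqrt _) (Num.sqrt _) => u v; nra.
have aabb : frame_a x ^+ 2 + frame_b x ^+ 2 = 1 - 4 * x ^+ 2.
  by rewrite /frame_a /frame_b; move: s1 s2; move: (Num.sqrt _) (Num.sqrt _) => u v; nra.
move: (frame_a x) (frame_b x) ab aabb => u v ab aabb.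
transitivity ((p * p' + q * q') * (u ^+ 2 + v ^+ 2) + 2 * (p * q' + q * p') * (u * v) +
  (2 * x * (p - q) + r) * (2 * x * (p' - q') + r')); first by ring.
by rewrite ab aabb; ring.
Qed.

Lemma skewB x p q r p' q' r' a :
  skew x p q r a - skew x p' q' r' a = skew x (p - p') (q - q') (r - r') a.
Proof. by case: a => [[|[|[|a]]] ha] //; rewrite /skew /=; ring. Qed.

Lemma skew_tends p q r a : tends (fun x => skew x p q r a) (skew 0 p q r a).
Proof.
have sq c : tends (fun x => Num.sqrt (1 + c * x ^+ 2)) (Num.sqrt (1 + c * 0 ^+ 2)).
  by apply/tends_sqrt/tendsD; [|apply: tendsM];
    [exact: tends_cst|exact: tends_cst|exact: tends_pow0].
have sq' : tends (fun x => Num.sqrt (1 - 10 * x ^+ 2)) (Num.sqrt (1 - 10 * 0 ^+ 2)).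
  by apply/tends_sqrt/tendsB; [|apply: tendsM];
    [exact: tends_cst|exact: tends_cst|exact: tends_pow0].
have ta : tends frame_a (frame_a 0).
  by apply: tendsM; [exact: tendsD|exact: tends_cst].
have tb : tends frame_b (frame_b 0).
  by apply: tendsM; [exact: tendsB|exact: tends_cst].
case: a => [[|[|[|a]]] ha] //; rewrite /skew /=.
- by apply: tendsD; apply: tendsM => //; exact: tends_cst.
- by apply: tendsD; apply: tendsM => //; exact: tends_cst.
- apply: tendsD; last exact: tends_cst.
  apply: tendsM; last exact: tends_cst.
  by apply: tendsM; [exact: tends_cst|exact: (tends_pow0 1)].
Qed.

End Frame.

(** An even ball [l > 0] hangs from the spine by one pendant edge. The spine starts at the
    ball [1], so that the edge [0] counts negatively in the path to the ball [0]. *)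
Definition path_coef (R : realType) (l f : nat) : R :=
  if l is l'.+1 then
    ((f %% 2 == 0) && (0 < f <= l' %/ 2 * 2) + ((l' %% 2 == 1) && (f == l')))%N%:R
  else - (f == 0)%N%:R.

Lemma path_coef_edge (R : realType) l f :
  path_coef R l.+1 f - path_coef R (parent l) f = (l == f)%:R.
Proof.
case: l => [|l]; rewrite /path_coef /parent.
  by rewrite opprK -natrD; congr _%:R; lia.
by apply/eqP; rewrite subr_eq -natrD; apply/eqP; congr _%:R; lia.
Qed.

(** With [b = 1] the ball [0] and the edge [0] are left out; the indices of balls and
    edges are then shifted by [1] with respect to the labels. *)
Section Caterpillar.
Variables (R : realType) (m b : nat).
Hypothesis b1 : (b <= 1)%N.

Definition edge_src (e : 'I_m) : 'I_m.+1 := inord (parent (e + b) - b).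
Definition edge_tgt (e : 'I_m) : 'I_m.+1 := inord e.+1.
Definition edge_adj : rel 'I_m := fun e f => coupled (e + b)%N (f + b)%N.

Definition balls (x : R) : 'M[R]_(m.+1, 3) := \matrix_(i, a)
  skew x (node_x (i + b))%:~R (node_y (i + b))%:~R (node_z (i + b))%:~R a.

Lemma edge_srcE e : (edge_src e + b)%N = parent (e + b).
Proof.
have h := parent_le (e + b); rewrite /edge_src inordK; last by have := ltn_ord e; lia.
by rewrite subnK // /parent; case: (e + b)%N (leq_addl e b) => //; lia.
Qed.

Lemma edge_tgtE e : edge_tgt e = e.+1 :> nat.
Proof. by rewrite /edge_tgt inordK // ltnS. Qed.

Lemma balls_edge x e a : balls x (edge_tgt e) a - balls x (edge_src e) a =
  skew x (dir_x (e + b))%:~R (dir_y (e + b))%:~R (dir_z (e + b))%:~R a.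
Proof.
have [<- <- <-] := node_edge (e + b).
by rewrite !mxE skewB edge_srcE edge_tgtE addSn !rmorphB.
Qed.

Lemma small_x : \forall x \near (0 : R)^'+, 10 * x ^+ 2 <= 1.
Proof.
have h : tends (fun x : R => 10 * x ^+ 2) 0.
  by have := tendsM (tends_cst (10 : R)) (tends_pow 1); rewrite mulr0.
by apply: filterS (tends_lt h ltr01) => x /ltW.
Qed.

Lemma edge_overlap (e f : 'I_m) : (e < f)%N ->
  overlap R edge_src edge_tgt e f =
  (parent (f + b) == parent (e + b))%N%:R - (parent (f + b) == (e + b).+1)%N%:R.
Proof.
move=> ef; have pe := parent_le (e + b).
have se := edge_srcE e; have sf := edge_srcE f.
have te := edge_tgtE e; have tf := edge_tgtE f.
have v (i j : 'I_m.+1) : (i == j) = (i + b == j + b)%N by rewrite eqn_add2r.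
rewrite /overlap /incidence !v se sf te tf !addSn.
have -> : ((f + b).+1 == (e + b).+1)%N = false by lia.
have -> : ((f + b).+1 == parent (e + b))%N = false by lia.
by ring.
Qed.

Lemma caterpillar : contact_tree edge_src edge_tgt edge_adj balls (balls 0)
  (fun i f => path_coef R (i + b) (f + b)).
Proof.
have lt_st e : (edge_src e < edge_tgt e)%N.
  by have := edge_srcE e; have := edge_tgtE e; have := parent_le (e + b); lia.
split=> //.
- move=> i a; under eq_fun do rewrite mxE.
  by rewrite mxE; exact: skew_tends.
- apply: filterS small_x => x x1 e; rewrite rdotC /rdot.
  under eq_bigr do rewrite balls_edge.
  rewrite skew_dot //; have [k hk] := mod4P (e + b).
  rewrite /dir_x /dir_y /dir_z.
  have [r [r4 ->]] : exists r, (r < 4)%N /\ ((e + b) %% 4 = r)%N.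
    by exists ((e + b) %% 4)%N; rewrite ltn_mod.
  by case: r r4 => [|[|[|[|r]]]] //= _; ring.
- move=> i j ij ne; rewrite /rdot.
  under eq_bigr do rewrite !mxE skewB.
  rewrite skew_dot; last by rewrite expr0n mulr0.
  rewrite expr0n /= !mulr0 !mul0r !addr0 -!rmorphB -!rmorphM -!rmorphD /=.
  have j0 : (0 < j)%N by lia.
  have lj : (j.-1 < m)%N by have := ltn_ord j; lia.
  pose e := Ordinal lj.
  have far : parent (j.-1 + b) != (i + b)%N.
    apply/eqP => pE; apply: (ne e); congr pair; apply: val_inj => /=.
      by have := edge_srcE e; rewrite /= pE; lia.
    by rewrite edge_tgtE /= prednK.
  have jE : (j.-1 + b).+1 = (j + b)%N by lia.
  have := @node_far (i + b) (j.-1 + b); rewrite jE ltn_add2r => /(_ ij far).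
  rewrite -(ler_int R) => h; apply: (@lt_le_trans _ _ 2%:~R); first by rewrite ltr1z.
  by apply: le_trans h _; rewrite ler_int; lia.
- apply: filterS small_x => x x1 e f ef; rewrite edge_overlap // /edge_dot.
  under eq_bigr do rewrite !balls_edge.
  rewrite skew_dot //.
  have lt_l : (e + b < f + b)%N by rewrite ltn_add2r.
  have [-> ->] := coupled_parent lt_l.
  have -> : (f - e)%N = (f + b - (e + b))%N by rewrite subnDr.
  rewrite /edge_adj; move: (e + b)%N (f + b)%N lt_l => l l' _ {e f ef}.
  have [|_] := boolP (coupled l l'); last by rewrite !andbF /= subrr mul0r.
  rewrite !andbT /coupled /dir_x /dir_y /dir_z.
  have l4 : (l %% 4 < 4)%N by rewrite ltn_mod.
  have -> : (l %% 2 = (l %% 4) %% 2)%N by lia.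
  case/orP=> [/eqP->|/andP[/eqP l2 /eqP->]].
    have -> : (l.+1 %% 4 = (l %% 4).+1 %% 4)%N by lia.
    rewrite subSnn expr1; move: (l %% 4)%N l4.
    by case=> [|[|[|[|r]]]] //= _; ring.
  have -> : (l.+2 %% 4 = (l %% 4).+2 %% 4)%N by lia.
  have -> : (l.+2 - l = 2)%N by lia.
  move: (l %% 4)%N l4 l2.
  by case=> [|[|[|[|r]]]] //= _ _; ring.
- by move=> e f; rewrite edge_srcE edge_tgtE addSn path_coef_edge eqn_add2r.
Qed.

End Caterpillar.

(** * The moments of the hits in the limit *)

Section Schedule.
Variable R : realType.
Implicit Types (h t c a eta theta : R) (s K w F : seq R).

(** The hits of a wall that is kicked at the moments [K] and hit first at [h]: each
    kick is the midpoint of the hits around it. *)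
Fixpoint mirror h K : seq R :=
  h :: if K is k :: K' then mirror (2 * k - h) K' else [::].

Fixpoint inter s w : seq R :=
  if s is x :: s' then x :: (if w is y :: w' then y :: inter s' w' else [::])
  else [::].

(** Hits, marked [true], and kicks in their order of succession. *)
Fixpoint zigzag h K : seq (R * bool) :=
  (h, true) :: if K is k :: K' then (k, false) :: zigzag (2 * k - h) K' else [::].

Lemma size_mirror h K : size (mirror h K) = (size K).+1.
Proof. by elim: K h => //= k K IH h; rewrite IH. Qed.

Lemma size_inter s w : size s = (size w).+1 -> size (inter s w) = (size w).*2.+1.
Proof. by elim: s w => //= x s IH [|y w] //= [sz]; rewrite IH // doubleS. Qed.

Lemma mem_inter s w t : size s = (size w).+1 ->
  (t \in inter s w) = (t \in s) || (t \in w).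
Proof.
elim: s w => //= x s IH [|y w] /= [sz]; first by case: s sz {IH} => // _; rewrite in_nil orbF.
by rewrite !inE IH //; do !case: (_ == _) => //=; rewrite orbT.
Qed.

Lemma zigzag_fst h K : map fst (zigzag h K) = inter (mirror h K) K.
Proof. by elim: K h => //= k K IH h; rewrite IH. Qed.

Lemma mem_zigzag h K t (own : bool) :
  ((t, own) \in zigzag h K) = if own then t \in mirror h K else t \in K.
Proof.
elim: K h => [|k K IH] h /=.
  by rewrite inE xpair_eqE; case: own; rewrite ?inE ?andbT ?andbF.
by rewrite !inE !xpair_eqE IH; case: own {IH}; rewrite ?inE ?andbT ?andbF.
Qed.

(** Closeness to the arithmetic progression of first term [c] and step [a]. *)
Fixpoint near_ap eta c a s : bool :=
  if s is x :: s' then (`|x - c| <= eta) && near_ap eta (c + a) a s' else true.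

Lemma near_ap_le eta eta' c a s : eta <= eta' -> near_ap eta c a s -> near_ap eta' c a s.
Proof.
move=> le; elim: s c => //= x s IH c /andP[h1 /IH ->].
by rewrite (le_trans h1).
Qed.

(** If kicks are regularly spaced, then hits that start halfway between two kicks
    stay halfway; deviations grow only linearly in the number of kicks. *)
Lemma near_mirror eta theta c a K h : 0 <= eta -> near_ap eta c a K ->
  `|h - (c - a / 2)| <= theta ->
  near_ap (theta + 2 * eta * (size K)%:R) (c - a / 2) a (mirror h K).
Proof.
move=> eta0; elim: K c h theta => [|k K IH] c h theta /=.
  by move=> _ hh; rewrite mulr0 addr0 hh.
case/andP=> hk hK hh; apply/andP; split.
  by apply: le_trans hh _; rewrite lerDl !mulr_ge0.
have -> : c - a / 2 + a = c + a - a / 2 by ring.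
have -> : theta + 2 * eta * (size K).+1%:R = theta + 2 * eta + 2 * eta * (size K)%:R.
  by rewrite -natr1; ring.
apply: IH => //; move: hk hh; rewrite !ler_norml; lra.
Qed.

Lemma near_inter eta c a s w : near_ap eta c a s -> near_ap eta (c + a / 2) a w ->
  near_ap eta c (a / 2) (inter s w).
Proof.
elim: s w c => //= x s IH [|y w] c /= /andP[-> hs] //= /andP[-> hw] /=.
have -> : c + a / 2 + a / 2 = c + a by field.
by apply: IH => //; rewrite addrAC.
Qed.

Lemma near_sorted eta c a s : 2 * eta < a -> near_ap eta c a s -> sorted <%R s.
Proof.
move=> ea; elim: s c => //= x [|y s] IH c //= /andP[hx /andP[hy hs]].
apply/andP; split; first by move: hx hy; rewrite !ler_norml; lra.
by apply: (IH (c + a)); rewrite /= hy.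
Qed.

Lemma avoid F c d : c < d -> exists h, [/\ c < h, h < d & h \notin F].
Proof.
elim: F c d => [|x F IH] c d cd; first by exists ((c + d) / 2); split => //; lra.
have [lt_xd|le_dx] := ltP x d; last first.
  have [h [h1 h2 h3]] := IH c d cd; exists h; split=> //.
  by rewrite inE negb_or h3 andbT lt_eqF //; lra.
have [h [h1 h2 h3]] : exists h, [/\ Num.max c x < h, h < d & h \notin F].
  by apply: IH; rewrite gt_max cd.
move: h1; rewrite gt_max => /andP[h1 h1']; exists h; split=> //.
by rewrite inE negb_or h3 andbT gt_eqF.
Qed.

(** Each hit is [h] or [- h] plus a constant, hence meets [F] for finitely many [h]
    only. *)
Lemma mirror_avoid K F : exists B : seq R,
  forall h, h \notin B -> forall t, t \in mirror h K -> t \notin F.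
Proof.
elim: K => [|k K [B hB]].
  by exists F => h hF t /=; rewrite inE => /eqP->.
exists (F ++ [seq 2 * k - y | y <- B]) => h.
rewrite mem_cat negb_or => /andP[hF hB'] t /=; rewrite inE => /orP[/eqP->//|].
apply: hB; apply: contra hB' => hin; apply/mapP; exists (2 * k - h) => //; ring.
Qed.

(** The moments at which a wall is kicked: by [l.-1], and also by [l.-2] if [l]
    is even. *)
Definition kick_times (H : nat -> seq R) (l : nat) : seq R :=
  if l is l'.+1 then
    if (l' %% 2 == 0)%N then H l' else inter (H l') (H l'.-1)
  else [::].

(** The wall [l.+1], where [l] is even, is kicked by [l]; the wall [l.+2] is kicked
    by [l] and [l.+1], whose hits alternate. *)
Record schedule (w0 : seq R) (J : nat) (H : nat -> seq R) (h0 : nat -> R) : Prop := {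
  sch_start : H 0%N = w0;
  sch_mirror : forall l, (0 < l <= J * 2)%N -> H l = mirror (h0 l) (kick_times H l);
  sch_sorted : forall l, (0 < l <= J * 2)%N ->
    sorted (fun x y : R * bool => x.1 < y.1) (zigzag (h0 l) (kick_times H l));
  sch_disjoint : forall l l' t, (l < l' <= J * 2)%N -> t \in H l -> t \notin H l'
}.

Lemma sorted_zigzag h K : sorted (fun x y : R * bool => x.1 < y.1) (zigzag h K) =
  sorted <%R (inter (mirror h K) K).
Proof. by rewrite -zigzag_fst sorted_map. Qed.

Definition append2 (T : Type) (j : nat) (H : nat -> T) (x y : T) (l : nat) : T :=
  if (l <= j)%N then H l else if l == j.+1 then x else y.

Lemma append2_le (T : Type) j (H : nat -> T) x y l :
  (l <= j)%N -> append2 j H x y l = H l.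
Proof. by rewrite /append2 => ->. Qed.

Lemma append2_1 (T : Type) j (H : nat -> T) x y : append2 j H x y j.+1 = x.
Proof. by rewrite /append2 ltnn eqxx. Qed.

Lemma append2_2 (T : Type) j (H : nat -> T) x y : append2 j H x y j.+2 = y.
Proof. by rewrite /append2 ltnNge leqnSn /= eqn_leq ltnn. Qed.

Lemma kick_times_append2 j H w1 w2 l : (l <= j)%N ->
  kick_times (append2 j H w1 w2) l = kick_times H l.
Proof.
case: l => // l lj; rewrite /kick_times (append2_le _ _ _ (ltnW lj)).
by rewrite (append2_le _ _ _ (leq_trans (leq_pred l) (ltnW lj))).
Qed.

Lemma le_double_cases J l : (0 < l <= J.+1 * 2)%N ->
  [\/ (0 < l <= J * 2)%N, l = (J * 2).+1 | l = (J * 2).+2].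
Proof.
move=> hl; have [?|?] := leqP l (J * 2); first by constructor 1; lia.
by have [?|?] := leqP l (J * 2).+1; [constructor 2|constructor 3]; lia.
Qed.

(** The hits of the walls [2 J + 1] and [2 J + 2] are chosen halfway between their
    kicks up to a small generic offset. Exact midpoints would make moments of
    different walls coincide: the wall [2 J + 3] would be hit halfway between the
    hits of the wall [2 J + 2], at its kicks, which are hits of the walls [2 J] and
    [2 J + 1]. The precision demanded from the hits [w] of the wall [2 J] absorbs
    the growth of the deviations, bounded by the factor [M]. *)
Lemma schedule_near (w0 : seq R) J : (forall eta a, 0 < eta -> exists c, near_ap eta c a w0) ->
  exists N : nat, forall eta, 0 < eta -> exists H (h0 : nat -> R) c, [/\ schedule w0 J H h0,
    size (H (J * 2)%N) = N & near_ap eta c (2 ^- J) (H (J * 2)%N)].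
Proof.
move=> near0; elim: J => [|J [N IH]].
  exists (size w0) => eta eta0; have [c hc] := near0 eta (2 ^- 0) eta0.
  by exists (fun=> w0), (fun=> 0), c; split=> //; split=> // l; lia.
exists (N.*2.+2) => eta eta0; pose a : R := 2 ^- J.
have a0 : 0 < a by rewrite invr_gt0 exprn_gt0.
pose M : R := 1 + 2 * (N.*2.+1)%:R * (N.*2.+1)%:R.
have M1 : 1 <= M by rewrite lerDl !mulr_ge0.
have [th [th0 thE tha]] : exists th, [/\ 0 < th, th * M <= eta & th * M < a / 16].
  exists (Num.min eta (a / 17) / M).
  have M0 : 0 < M by lra.
  split; first by rewrite divr_gt0 // lt_min eta0; lra.
    by rewrite divfK ?lt0r_neq0 // ge_min lexx.
  by rewrite divfK ?lt0r_neq0 // gt_min orbC; apply/orP; left; lra.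
have [H [h0 [c [sch szw near]]]] := IH th th0; set w := H (J * 2)%N in szw near.
pose F0 := flatten [seq H l | l <- iota 0 (J * 2).+1].
have F0P l t : (l <= J * 2)%N -> t \in H l -> t \in F0.
  move=> lJ tl; apply/flattenP; exists (H l) => //.
  by apply/map_f; rewrite mem_iota /= add0n ltnS.
have near_pick K F (u : R) : exists h, `|h - u| <= th /\
    forall t, t \in mirror h K -> t \notin F.
  have [B hB] := mirror_avoid K F.
  have [|h [h1 h2 h3]] := @avoid B (u - th) (u + th); first lra.
  by exists h; split; [rewrite ler_norml; lra|exact: hB].
have [h1 [h1c h1F]] := near_pick w F0 (c - a / 2).
set w1 := mirror h1 w in h1F.
have sz1 : size w1 = (size w).+1 by rewrite size_mirror.
pose th1 := th * (N.*2.+1)%:R.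
have near1 : near_ap th1 (c - a / 2) a w1.
  apply: near_ap_le (near_mirror (ltW th0) near h1c).
  have -> : th1 = th + 2 * th * N%:R by rewrite /th1 -addn1 natrD -mul2n natrM; ring.
  by rewrite szw.
have th_1 : th <= th1 by apply: ler_peMr; [exact: ltW|rewrite ler1n].
set K := inter w1 w.
have nearK : near_ap th1 (c - a / 2) (a / 2) K.
  by apply: near_inter => //; rewrite subrK; exact: near_ap_le near.
have szK : size K = N.*2.+1 by rewrite size_inter // szw.
have [h2 [h2c h2F]] := near_pick K (F0 ++ w1) (c - a / 2 - a / 2 / 2).
set w2 := mirror h2 K in h2F.
have near2 : near_ap (th * M) (c - a / 2 - a / 2 / 2) (a / 2) w2.
  have th10 : 0 <= th1 by rewrite mulr_ge0 // ltW.
  apply: near_ap_le (near_mirror th10 nearK h2c).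
  by rewrite szK /th1 /M; lra.
have th_M : th1 <= th * M.
  rewrite ler_pM2l // /M.
  have : 1 <= (N.*2.+1)%:R :> R by rewrite ler1n.
  move: (N.*2.+1)%:R => y y1; nra.
pose H' := append2 (J * 2) H w1 w2; pose h0' := append2 (J * 2) h0 h1 h2.
exists H', h0', (c - a / 2 - a / 2 / 2).
have HE l : (l <= J * 2)%N -> H' l = H l by exact: append2_le.
have H1 : H' (J * 2).+1 = w1 by exact: append2_1.
have H2 : H' (J * 2).+2 = w2 by exact: append2_2.
have k1 : kick_times H' (J * 2).+1 = w by rewrite /kick_times modnMl eqxx HE.
have k2 : kick_times H' (J * 2).+2 = K.
  by rewrite /kick_times -addn1 modnMDl /= addn1 H1 HE.
have h01 : h0' (J * 2).+1 = h1 by exact: append2_1.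
have h02 : h0' (J * 2).+2 = h2 by exact: append2_2.
split.
- split=> [|l hl|l hl|l l' t /andP[ll' hl'] tl].
  + by rewrite HE // (sch_start sch).
  + case: (le_double_cases hl) => [lJ|->|->].
    * have [_ lJ'] := andP lJ.
      by rewrite kick_times_append2 // HE // /h0' append2_le // (sch_mirror sch).
    * by rewrite k1 h01 H1.
    * by rewrite k2 h02 H2.
  + rewrite sorted_zigzag; case: (le_double_cases hl) => [lJ|->|->].
    * have [_ lJ'] := andP lJ.
      rewrite -sorted_zigzag kick_times_append2 // /h0' append2_le //.
      exact: (sch_sorted sch).
    * by rewrite k1 h01; apply: near_sorted nearK; lra.
    * rewrite k2 h02; apply: (@near_sorted (th * M) (c - a / 2 - a / 2 / 2) (a / 2 / 2)).
        by lra.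
      by apply: near_inter => //; rewrite subrK; exact: near_ap_le nearK.
  + have l'0 : (0 < l' <= J.+1 * 2)%N by rewrite (leq_ltn_trans _ ll').
    have tF : (l <= J * 2)%N -> t \in F0.
      by move=> lJ; apply: (F0P l); rewrite -?HE.
    case: (le_double_cases l'0) => [/andP[_ lJ]|l'E|l'E].
    * have lJ' := leq_trans (ltnW ll') lJ.
      by rewrite HE //; apply: (sch_disjoint sch (l := l)); rewrite -?HE // ll'.
    * rewrite l'E H1; apply/negP => /h1F /negP; apply; apply: tF.
      by rewrite -ltnS -l'E.
    * rewrite l'E H2; apply/negP => /h2F /negP; apply; rewrite mem_cat.
      have [lJ|lJ] := leqP l (J * 2); first by rewrite tF.
      have lE : l = (J * 2).+1 by apply/eqP; rewrite eqn_leq lJ -ltnS -l'E ll'.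
      by move: tl; rewrite lE H1 => ->; rewrite orbT.
- by rewrite mulSn add2n H2 size_mirror szK.
- have -> : 2 ^- J.+1 = a / 2 :> R by rewrite exprSr invfM.
  by rewrite mulSn add2n H2; apply: near_ap_le near2.
Qed.

End Schedule.

(** * Following a schedule *)

Section Run.
Variables (R : realType) (n m d : nat) (src tgt : 'I_m -> 'I_n) (cpl : rel 'I_m).
Variables (Q : R -> 'M[R]_(n, d)) (Q0 : 'M[R]_(n, d)) (coef : 'I_n -> 'I_m -> R).
Hypothesis tree : contact_tree src tgt cpl Q Q0 coef.
Implicit Types (e f : 'I_m) (t : R) (l : seq (R * 'I_m)) (X S : 'I_m -> R).

Definition kicks e f := (e < f)%N && cpl e f.

Definition seen_by f l : seq (R * bool) :=
  [seq (p.1, p.2 == f) | p <- l & (p.2 == f) || kicks p.2 f].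

(** At the time [t], the wall [f] has the gap [x] and the speed [s], and the events
    [l] are those of a point bouncing off [f] in the future: [h] is its next hit
    if [s = -1], its last one if [s = 1]. *)
Definition in_phase f t (x s : R) l := 0 < x /\ exists h K, x = s * (t - h) /\
  ((s = -1 /\ seen_by f l = zigzag h K) \/
   (s = 1 /\ seen_by f l = behead (zigzag h K))).

Lemma seen_by_time f l t h own : all (fun p => t < p.1) l ->
  (h, own) \in seen_by f l -> t < h.
Proof.
move=> /allP tl /mapP[[t1 e]]; rewrite mem_filter => /andP[_ /tl /= h1] [-> _].
exact: h1.
Qed.

(** An event preserves the phase of each wall: it is the next hit of [e], a kick of
    the walls coupled to [e] and numbered after it, which are receding because a
    kick is next in their zigzag, and nothing to the others. *)
Lemma in_phase_step f e t t1 t2 X S l : t < t1 -> t1 < t2 ->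
  all (fun p => t2 < p.1) l -> S e = -1 -> X e = t1 - t ->
  in_phase f t (X f) (S f) ((t1, e) :: l) ->
  (f != e -> 0 < X f + X e * S f) /\
  in_phase f t2 (X f + X e * S f + (t2 - t1) * kicked cpl e S f) (kicked cpl e S f) l.
Proof.
move=> tt1 t12 tl Se Xe [X0 [h [K [XE ph]]]].
move: ph; rewrite /kicked /seen_by /= (eq_sym e); have [fe|ne] /= := eqVneq f e.
  rewrite fe in XE X0 *; split => //; rewrite Se opprK.
  split; first by rewrite Xe; lra.
  exists h, K; rewrite mul1r; case: ph => [[_ zz]|[S1 _]]; last by exfalso; rewrite Se in S1; lra.
  have ht1 : h = t1 by move: XE; rewrite Se Xe; lra.
  split; first by rewrite Xe ht1; lra.
  by right; split=> //; rewrite -[in RHS]zz.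
have [kef|nkef] /= := boolP (kicks e f).
  rewrite (eq_sym e) (negPf ne) -/(kicks e f) kef => -[[_]|[Sf]]; first by case: K {XE}.
  case: K XE => // k K XE [<- zz].
  have h2 : t2 < 2 * t1 - h.
    apply: (seen_by_time (own := true) tl (f := f)); rewrite /seen_by zz.
    by case: (K) => *; rewrite inE eqxx.
  rewrite Sf Se in XE *; split; first by rewrite Xe; lra.
  split; first by rewrite Xe; lra.
  exists (2 * t1 - h), K; split; first by rewrite Xe; lra.
  by left; split=> //; lra.
rewrite -/(kicks e f) (negPf nkef) -/(seen_by f l) => ph.
have pos : 0 < X f + X e * S f /\ 0 < S f * (t2 - h).
  case: ph => -[Sf zz]; rewrite XE Sf Xe in X0 *.
    have : t2 < h; last by lra.
    apply: (seen_by_time (own := true) tl (f := f)); rewrite zz.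
    by case: (K) => *; rewrite inE eqxx.
  by lra.
have E : X f + X e * S f + (t2 - t1) * S f = S f * (t2 - h) by rewrite XE Xe; ring.
split; first by case: pos.
by split; rewrite E; [case: pos|exists h, K].
Qed.

Lemma shadow_reach_run l t N X S : path <%R t (map fst l) ->
  (forall f, in_phase f t (X f) (S f) l) ->
  shadow_reach src tgt Q N X S ->
  exists X' S', shadow_reach src tgt Q (N + size l) X' S'.
Proof.
elim: l t N X S => [|[t1 e] l IH] t N X S /=.
  by move=> _ _ rch; exists X, S; rewrite addn0.
case/andP=> tt1 pl ph rch.
have [t2 [t12 pt2]] : exists t2, t1 < t2 /\ path <%R t2 (map fst l).
  case: l pl {IH ph} => [|p l] /=; first by exists (t1 + 1); split=> //; lra.
  by case/andP=> tp ->; exists ((t1 + p.1) / 2); rewrite andbT; split; lra.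
have tl : all (fun p => t2 < p.1) l.
  by have := order_path_min lt_trans pt2; rewrite all_map.
have [Se Xe] : S e = -1 /\ X e = t1 - t.
  have [X0 [h [K [XE]]]] := ph e; rewrite /seen_by /= !eqxx /= eqxx.
  case=> -[Se zz]; last by case: K zz.
  split=> //; rewrite XE Se.
  by case: K zz => [|k K] [-> _]; ring.
have step f := in_phase_step tt1 t12 tl Se Xe (ph f).
rewrite addnS -addSn; apply: (IH t2) => //; last first.
  apply: (shadow_reach_hit tree rch _ Se _ (sg := t2 - t1)) => [f|f ne| |f ne].
  - by have [] := ph f.
  - by have [/(_ ne)] := step f.
  - by rewrite subr_gt0.
  - by have [_ []] := step f.
by move=> f; have [] := step f.
Qed.

End Run.

(** * Counting the hits *)

Section Assembly.
Variables (R : realType) (w0 : seq R) (J : nat) (H : nat -> seq R) (h0 : nat -> R).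
Hypothesis sch : schedule w0 J H h0.

Lemma zigzag_own (h : R) K : [seq p.1 | p <- zigzag h K & p.2] = mirror h K.
Proof. by elim: K h => //= k K IH h; rewrite IH. Qed.

(** In a schedule a wall is kicked exactly at the hits of the earlier walls coupled
    to it. *)
Lemma schedule_kickers l t : (l <= J * 2)%N ->
  (t \in kick_times H l) <-> exists2 l', (l' < l)%N && coupled l' l & t \in H l'.
Proof.
case: l => [|l] lJ; first by split=> // -[l' /andP[]].
have adj l' : (l' < l.+1)%N && coupled l' l.+1 ->
    l' = l \/ [/\ (l %% 2)%N <> 0%N, l' = l.-1 & (l' < l)%N].
  rewrite /coupled => hl'.
  have [|[? [? ?]]] : l' = l \/ (l %% 2)%N <> 0%N /\ l' = l.-1 /\ (l' < l)%N.
  - by move: hl'; clear; lia.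
  - by left.
  - by right.
rewrite /kick_times; case: eqP => l2.
  split=> [tl|[l' /adj[->|[]//]]] //.
  by exists l => //; rewrite /coupled eqxx ltnSn.
have l0 : (0 < l)%N by rewrite lt0n; apply/eqP => l_0; case: l2; rewrite l_0.
have sz : size (H l) = (size (H l.-1)).+1.
  rewrite (sch_mirror sch) ?size_mirror ?l0 ?(ltnW lJ) // /kick_times.
  case: l l2 {lJ adj l0} => // l l2; rewrite ifT //; apply/eqP; clear -l2; lia.
rewrite mem_inter //; split=> [/orP[tl|tl]|[l' /adj[->|[_ -> _]] ->]].
- by exists l => //; rewrite /coupled eqxx ltnSn.
- exists l.-1 => //; rewrite /coupled; clear -l2 l0; lia.
- by [].
- by rewrite orbT.
Qed.

Lemma schedule_uniq l : (0 < l <= J * 2)%N -> uniq (H l).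
Proof.
move=> hl; rewrite (sch_mirror sch hl) -zigzag_own.
have := sch_sorted sch hl; set z := zigzag _ _ => sz.
apply: (@subseq_uniq _ _ (map fst z)); first exact/map_subseq/filter_subseq.
by apply: lt_sorted_uniq; rewrite sorted_map.
Qed.

(** Two more walls turn [n] hits of the last wall into [2 n + 2]. *)
Lemma schedule_size j : (j <= J)%N ->
  (\sum_(l < (j * 2).+1) size (H l) + 3 * j + 3 * (size w0 + 2) =
     size w0 + 3 * ((size w0 + 2) * 2 ^ j))%N /\
  (size (H (j * 2)) + 2 = (size w0 + 2) * 2 ^ j)%N.
Proof.
elim: j => [_|j IH jJ].
  by rewrite big_ord_recl big_ord0 /= (sch_start sch) expn0; clear; lia.
have [IH1 IH2] := IH (ltnW jJ).
have s1 : size (H (j * 2).+1) = (size (H (j * 2))).+1.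
  rewrite (sch_mirror sch); last by clear -jJ; lia.
  by rewrite size_mirror /kick_times modnMl.
have s2 : size (H (j * 2).+2) = (size (H (j * 2))).*2.+2.
  rewrite (sch_mirror sch); last by clear -jJ; lia.
  have odd_l : ((j * 2).+1 %% 2 = 1)%N by clear; lia.
  by rewrite size_mirror /kick_times odd_l /= size_inter ?s1.
rewrite mulSn add2n !big_ord_recr /= s1 s2 expnS.
move: IH1 IH2; rewrite big_ord_recr /=; move: (\sum_(_ < _) _)%N (size (H (j * 2))) => S n.
by clear; move: (2 ^ j)%N => p; rewrite -!mul2n; nia.
Qed.

End Assembly.

(** All the hits, sorted by time, are the events of a run; the events that matter to
    one wall form its zigzag since both lists are strictly sorted. *)
Lemma schedule_collisions (R : realType) (J b : nat) (H : nat -> seq R) (h0 : nat -> R) :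
  (b <= 1)%N -> schedule (nseq (1 - b) 0) J H h0 ->
  has_trajectory_with_collisions R ((J * 2).+1 - b).+1 3
    (\sum_(l < (J * 2).+1) size (H l)).
Proof.
move=> b1 sch; set m := ((J * 2).+1 - b)%N.
have tree := caterpillar R m b1.
have lab (e : 'I_m) : (e + b <= J * 2)%N by have := ltn_ord e; rewrite /m; clear; lia.
pose hh (e : 'I_m) := if (e + b == 0)%N then 0 else h0 (e + b)%N.
have HE (e : 'I_m) : H (e + b)%N = mirror (hh e) (kick_times H (e + b)).
  rewrite /hh; case: eqP => [e0|/eqP e0]; last by rewrite (sch_mirror sch) // lt0n e0 lab.
  by rewrite e0 (sch_start sch); have -> : b = 0%N by clear -e0; lia.
have zzE (e : 'I_m) : sorted (fun x y : R * bool => x.1 < y.1) (zigzag (hh e) (kick_times H (e + b))).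
  rewrite /hh; case: eqP => [->//|/eqP e0]; apply: (sch_sorted sch).
  by rewrite lt0n e0 lab.
have uH (e : 'I_m) : uniq (H (e + b)%N).
  case: (posnP (e + b)) => [e0|e0]; last by apply: (schedule_uniq sch); rewrite e0 lab.
  by rewrite e0 (sch_start sch); clear; case: b => [|[|b]].
pose l0 := flatten [seq [seq (h, e) | h <- H (e + b)%N] | e : 'I_m <- enum 'I_m].
pose l := sort (fun p q : R * 'I_m => p.1 <= q.1) l0.
have meml p : (p \in l) = (p.1 \in H (p.2 + b)%N).
  rewrite mem_sort; apply/flattenP/idP => [[_ /mapP[e _ ->]] /mapP[h hin ->] //|hin].
  exists [seq (h, p.2) | h <- H (p.2 + b)%N].
    by apply: map_f; rewrite mem_enum.
  by apply/mapP; exists p.1 => //; case: p {hin}.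
have ul : uniq (map fst l).
  have /perm_uniq -> : perm_eq (map fst l) (map fst l0) by apply: perm_map; rewrite perm_sort.
  rewrite /l0; elim: (enum 'I_m) (enum_uniq 'I_m) => //= e s IH /andP[es us].
  rewrite map_cat -map_comp map_id cat_uniq uH IH // andbT.
  apply/hasPn => _ /mapP[[t f] /flattenP[_ /mapP[f' f's ->] /mapP[u uin [-> _]]] ->] /=.
  have [ef|fe|ef] := ltngtP e f'.
  - apply/negP => ue; have := sch_disjoint sch (l := e + b) (l' := f' + b) (t := u).
    by rewrite ltn_add2r ef lab /= => /(_ isT ue); rewrite uin.
  - have := sch_disjoint sch (l := f' + b) (l' := e + b) (t := u).
    by rewrite ltn_add2r fe lab /= => /(_ isT uin).
  - by rewrite (val_inj ef) f's in es.
have sl : sorted <%R (map fst l).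
  rewrite lt_sorted_uniq_le ul sorted_map.
  by apply: sort_sorted => p q; exact: le_total.
have seen (f : 'I_m) : seen_by (edge_adj b) f l = zigzag (hh f) (kick_times H (f + b)).
  apply: (@irr_sorted_eq _ (fun x y : R * bool => x.1 < y.1)) => [x y z|x| | |].
  - exact: lt_trans.
  - exact: ltxx.
  - rewrite sorted_map; apply: sorted_filter; first by move=> x y z; exact: lt_trans.
    by rewrite sorted_map in sl.
  - exact: zzE.
  - case=> t own; rewrite mem_zigzag -HE; apply/mapP/idP.
      case=> -[u e]; rewrite mem_filter meml /= => /andP[ef uin] [-> ->].
      have [<- //|ne] := eqVneq e f.
      rewrite (negPf ne) /= in ef.
      apply/(schedule_kickers sch _ (lab f)); exists (e + b)%N => //.
      by rewrite ltn_add2r.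
    case: own => [tf|/(schedule_kickers sch _ (lab f))[l' /andP[l'f cl'] tl']].
      by exists (t, f); rewrite ?mem_filter ?meml /= eqxx.
    have bl' : (b <= l')%N.
      rewrite leqNgt; apply/negP => l'b.
      have [b_1 l'0] : b = 1%N /\ l' = 0%N by clear -b1 l'b; lia.
      by rewrite l'0 (sch_start sch) b_1 in tl'.
    have lm : (l' - b < m)%N by have := ltn_ord f; clear -bl' l'f; lia.
    exists (t, Ordinal lm) => /=.
      rewrite mem_filter meml /= subnK // tl' andbT /kicks /edge_adj /= subnK // cl' andbT.
      by rewrite ltn_subLR // [(b + f)%N]addnC l'f orbT.
    congr pair; apply/esym/negbTE; rewrite -val_eqE /= neq_ltn.
    by rewrite ltn_subLR // [(b + f)%N]addnC l'f.
have [t0 pt0] : exists t0, path <%R t0 (map fst l).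
  case: (map fst l) sl => [|x s] /=; first by exists 0.
  by move=> ->; exists (x - 1); rewrite andbT; lra.
have phase (f : 'I_m) : in_phase (edge_adj b) f t0 (hh f - t0) (-1) l.
  split; last by exists (hh f), (kick_times H (f + b)); split; [ring|left].
  rewrite subr_gt0; have /allP := order_path_min lt_trans pt0; apply.
  apply/mapP; exists (hh f, f) => //; rewrite meml /= HE.
  by case: (kick_times _ _) => *; rewrite inE eqxx.
have [X' [S']] := shadow_reach_run tree pt0 phase (shadow_reach0 tree _ _).
move=> /(shadow_reach_collisions (n := m.+1)).
rewrite add0n.
have -> // : size l = (\sum_(l < (J * 2).+1) size (H l))%N.
rewrite size_sort size_flatten /shape -map_comp sumnE big_map big_enum /=.
under eq_bigr do rewrite size_map.
rewrite -(big_mkord xpredT (fun i => size (H i))).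
rewrite -(big_mkord xpredT (fun i => size (H (i + b)%N))).
case: b b1 @m {tree lab hh HE zzE uH l0 l meml ul sl seen t0 pt0 phase X' S'} sch
  => [|[|//]] _ /= sch'.
  by rewrite subn0; under eq_bigr do rewrite addn0.
rewrite subn1 /= [RHS]big_nat_recl //= (sch_start sch') /=.
by under eq_bigr do rewrite addn1.
Qed.

Theorem mainTheorem2 (R : realType) (m k : nat) (hm : (1 <= m)%N)
    (hk : (1 <= k)%N) :
  (m = (2 * k - 1)%N ->
     ((2 ^+ (k + 2) + 2 ^+ (k - 1) - 3 * k%:R - 5)%:E <= MaxCol R (m + 1) 3)%E)
  /\
  (m = (2 * k)%N ->
     ((2 ^+ (k + 2) + 2 ^+ (k + 1) - 3 * k%:R - 6)%:E <= MaxCol R (m + 1) 3)%E).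
Proof.
have build (b J : nat) : (b <= 1)%N -> exists N, has_trajectory_with_collisions R
    ((J * 2).+1 - b).+1 3 N /\
    (N + 3 * J + 3 * ((1 - b) + 2) = (1 - b) + 3 * (((1 - b) + 2) * 2 ^ J))%N.
  move=> b1.
  have [|N0 hN] := @schedule_near R (nseq (1 - b) 0) J.
    move=> eta a eta0; exists 0; case: b b1 => [|[|//]] _ //=.
    by rewrite subr0 normr0 ltW.
  have [H [h0 [c [sch _ _]]]] := hN 1 ltr01.
  exists (\sum_(l < (J * 2).+1) size (H l))%N; split; first exact: schedule_collisions sch.
  by have [+ _] := schedule_size sch (leqnn J); rewrite size_nseq.
have pow2 i : (2 ^ i)%N%:R = 2 ^+ i :> R by rewrite natrX.
split=> mE.
- have [N [tr NE]] := build 0%N k.-1 isT.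
  have -> : (m + 1 = ((k.-1 * 2).+1 - 0).+1)%N by clear -hk mE; lia.
  move/MaxCol_geP: tr; congr (_ <= _)%E; congr EFin.
  have /(congr1 (fun i => i%:R : R)) : (N + 3 * k.-1 + 9 = 1 + 9 * 2 ^ k.-1)%N.
    by move: NE; clear; move: (2 ^ k.-1)%N => p; lia.
  rewrite (natrD _ (N + _)%N) (natrD _ N) (natrM _ 3) (natrD _ 1%N) (natrM _ 9) pow2 => NR.
  have -> : (k + 2 = k.-1 + 3)%N by clear -hk; lia.
  have -> : k%:R = k.-1%:R + 1 :> R by rewrite natr1 prednK.
  rewrite subn1 exprD; move: NR; clear; move: (2 ^+ k.-1) k.-1%:R => p r; lra.
- have [N [tr NE]] := build 1%N k isT.
  have -> : (m + 1 = ((k * 2).+1 - 1).+1)%N by clear -hk mE; lia.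
  move/MaxCol_geP: tr; congr (_ <= _)%E; congr EFin.
  have /(congr1 (fun i => i%:R : R)) : (N + 3 * k + 6 = 6 * 2 ^ k)%N.
    by move: NE; clear; move: (2 ^ k)%N => p; lia.
  rewrite (natrD _ (N + _)%N) (natrD _ N) (natrM _ 3) (natrM _ 6) pow2 => NR.
  rewrite !exprD; move: NR; clear; move: (2 ^+ k) k%:R => p r; lra.
Qed.
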